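(* Let $n\ge 2$, $N=\{1,\dots,n\}$, and let $F$ be a bargaining solution on $\mathcal{B}$. Then $F$ satisfies intermediate Pareto, scale invariance, anonymity, continuity, weak IIA, and independence of timing if and only if there exists a nonempty, symmetric, compact collection $\mathcal{W}$ of nonempty, closed, convex subsets of $\Delta$ such that, for all $S\in\mathcal{B}$, $$F(S)=\operatorname*{arg\,max}_{x\in S}\left\{\max_{W\in\mathcal{W}}\min_{w\in W}\prod_{i\in N}\left(\frac{x_i}{b_i(S)}\right)^{w_i}\right\}.$$
   Context: Notation: $\mathbb{R}_+$ and $\mathbb{R}_{++}$ are the nonnegative and the positive reals; $\mathbb{N}$ is the set of positive integers. For $a,b\in\mathbb{R}^n$: $a\ge b$ means $a_i\ge b_i$ for all $i$; $a\gg b$ means $a_i>b_i$ for all $i$; $a>b$ means $a\ge b$ and $a\ne b$. For $a,x\in\mathbb{R}^n$, $ax=(a_1x_1,\dots,a_nx_n)$, and $aS=\{ax\mid x\in S\}$ for $S\subset\mathbb{R}^n$. For $x\in\mathbb{R}^n_+$ and $m\in\mathbb{N}$, $x^m=(x_1^m,\dots,x_n^m)$, and for $S\in\mathcal{B}$, $S^m=\{x^m\mid x\in S\}$. $\Pi$ is the set of permutations of $N$; for $\pi\in\Pi$, $x^\pi=(x_{\pi(1)},\dots,x_{\pi(n)})$. A set $A\subset\mathbb{R}^n$ is symmetric if $A=\{x^\pi\mid x\in A\}$ for all $\pi\in\Pi$. Problems: $\mathcal{B}$ is the set of all nonempty sets $S\subset\mathbb{R}^n_+$ that are compact, comprehensive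 (for all $x,y\in\mathbb{R}^n_+$, if $x\in S$ and $y\le x$ then $y\in S$), and such that for every $i\in N$ there is $x\in S$ with $x_i>0$. Convexity is not assumed. For $S\in\mathcal{B}$, $b_i(S)=\max_{x\in S}x_i$. $\mathcal{B}^{\mathrm{Eq}}=\{S\in\mathcal{B}\mid b_i(S)=b_j(S)\text{ for all }i,j\in N\}$. A bargaining solution $F$ assigns to each $S\in\mathcal{B}$ a nonempty subset $F(S)\subset S$. Axioms: - Intermediate Pareto: for all $S\in\mathcal{B}$ and $x\in F(S)$, there is no $y\in S$ with $y\gg x$; furthermore, for some $x'\in F(S)$ there is no $y'\in S$ with $y'>x'$. - Scale invariance: for all $S\in\mathcal{B}$ and $a\in\mathbb{R}^n_{++}$, $F(aS)=aF(S)$. - Anonymity: for all symmetric $S\in\mathcal{B}$, if $x\in F(S)$, then $x^\pi\in F(S)$ for all $\pi\in\Pi$. - Continuity: for all $S\in\mathcal{B}$ and $x\in S$, if there exist sequences $\{S^k\}_{k\in\mathbb{N}}\subset\mathcal{B}$ and $\{x^k\}_{k\in\mathbb{N}}\subset\mathbb{R}^n$ (here $k$ is a sequence index) with $x^k\in F(S^k)$ for all $k$, $S^k\to S$ in the Hausdorff topology, and $x^k\to x$, then $x\in F(S)$. - Weak IIA: for all $S,S'\in\mathcal{B}^{\mathrm{Eq}}$ with $S'\subset S$, if $S'\cap F(S)\neq\emptyset$, then $F(S')=S'\cap F(S)$. - Independence of timing: for all $S\in\mathcal{B}$, $x\in S$, and $m\in\mathbb{N}$, $x\in F(S)$ if and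 only if $x^m\in F(S^m)$ (coordinatewise powers). Weights: $\Delta=\{w\in\mathbb{R}^n_+\mid\sum_{i\in N}w_i=1\}$. A collection $\mathcal{W}$ of subsets of $\Delta$ is symmetric if for all $W\in\mathcal{W}$ and $\pi\in\Pi$, $\{w^\pi\mid w\in W\}\in\mathcal{W}$. Compactness of $\mathcal{W}$ is with respect to the Hausdorff topology. Convention: the function $V(y)=\max_{W\in\mathcal{W}}\min_{w\in W}\prod_{i\in N}y_i^{w_i}$ is given by this formula for $y\in\mathbb{R}^n_{++}$, and its values at $y\in\mathbb{R}^n_+$ with some zero coordinate are those of its continuous extension from $\mathbb{R}^n_{++}$ to $\mathbb{R}^n_+$. *)

(* Defs.v *)
From HB Require Import structures.
From mathcomp Require Export all_boot all_order all_algebra all_fingroup.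
From mathcomp Require Export all_classical all_reals all_analysis.
Export Order.TTheory GRing.Theory Num.Theory.
Export numFieldNormedType.Exports.

Set Implicit Arguments.
Unset Strict Implicit.
Unset Printing Implicit Defensive.

Local Open Scope classical_set_scope.
Local Open Scope ring_scope.

(** Hyperspace of a pseudometric space, with the Hausdorff topology. The
    instances are put on the alias because [set T] is a function type. All
    subsets are included: a family of nonempty compact sets is compact here iff
    it is compact for the Hausdorff metric, as compactness does not depend on
    the ambient space. *)
Definition hyperspace (R : numFieldType) (T : pseudoMetricType R) : Type :=
  set T.

Section Hausdorff.
Variables (R : numFieldType) (T : pseudoMetricType R).
Implicit Types (A B C : hyperspace T) (e : R).

Definition hausdorff_ball A e B : Prop :=
  (forall x, A x -> exists2 y, B y & ball x e y) /\
  (forall y, B y -> exists2 x, A x & ball y e x).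

Let ent := entourage_ hausdorff_ball.

Lemma hausdorff_ball_center A e : 0 < e -> hausdorff_ball A e A.
Proof. by move=> e0; split=> x Ax; exists x => //; exact: ballxx. Qed.

Lemma hausdorff_ball_sym A B e : hausdorff_ball A e B -> hausdorff_ball B e A.
Proof. by case. Qed.

Lemma hausdorff_ball_triangle A B C e1 e2 :
  hausdorff_ball A e1 B -> hausdorff_ball B e2 C ->
  hausdorff_ball A (e1 + e2) C.
Proof.
move=> [AB BA] [BC CB]; split=> [x /AB[y /BC[z Cz yz] xy]|
                                 z /CB[y /BA[x Ax yx] zy]].
  by exists z => //; exact: ball_triangle xy yz.
by exists x => //; rewrite addrC; exact: ball_triangle zy yx.
Qed.

HB.instance Definition _ := Choice.copy (hyperspace T) (set T).
HB.instance Definition _ := hasNbhs.Build (hyperspace T) (nbhs_ ent).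
HB.instance Definition _ := Nbhs_isPseudoMetric.Build R (hyperspace T)
  erefl hausdorff_ball_center hausdorff_ball_sym hausdorff_ball_triangle erefl.

End Hausdorff.

Section Extrema.
Variable R : realType.

Definition is_max (A : set R) (m : R) := A m /\ ubound A m.
Definition is_min (A : set R) (m : R) := A m /\ lbound A m.

Definition argmax (T : Type) (S : set T) (f : T -> R) : set T :=
  [set x | S x /\ forall y, S y -> f y <= f x].

End Extrema.

Section Bargaining.
Variables (R : realType) (n : nat).
Implicit Types (a w x y : 'rV[R]_n) (A S W : set 'rV[R]_n) (i j : 'I_n).

Definition vle x y := forall i, x 0 i <= y 0 i.
Definition vlt x y := vle x y /\ x <> y.
Definition vltall x y := forall i, x 0 i < y 0 i.

Definition orthant : set 'rV[R]_n := [set x | vle 0 x].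
Definition pos_orthant : set 'rV[R]_n := [set x | vltall 0 x].

Definition vmul a x : 'rV[R]_n := map2_mx *%R a x.
Definition vpow (m : nat) x : 'rV[R]_n := map_mx (fun t => t ^+ m) x.

(** [col_perm p x] is the vector whose [i]-th entry is [x 0 (p i)]. *)
Definition symmetric_set A := forall p : 'S_n, A = col_perm p @` A.

Definition comprehensive S :=
  forall x y, orthant x -> orthant y -> S x -> vle y x -> S y.

Definition problem S :=
  [/\ S !=set0, S `<=` orthant, compact S, comprehensive S
    & forall i, exists2 x, S x & 0 < x 0 i].

(** On problems the supremum is a maximum, see [bestP]. *)
Definition best S i : R := sup [set x 0 i | x in S].

Lemma bestP S i : problem S -> is_max [set x 0 i | x in S] (best S i).
Proof.
move=> [[x0 Sx0] _ cS _ _].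
have [c Sc maxc] : exists2 c, S c & forall t, S t -> t 0 i <= c 0 i.
  have Sn0 : S !=set0 by exists x0.
  have cf : {within S, continuous (fun x : 'rV[R]_n => x 0 i)}.
    by apply: continuous_subspaceT => x; exact: coord_continuous.
  have [c cS' h] := compact_EVT_max Sn0 cS cf.
  by exists c; [exact: set_mem|move=> t /mem_set; exact: h].
have ub : ubound [set x 0 i | x in S] (c 0 i) by move=> _ [t St <-]; exact: maxc.
suff -> : best S i = c 0 i by split=> //; exists c.
apply/eqP; rewrite eq_le; apply/andP; split.
  by apply: ge_sup ub; exists (x0 0 i), x0.
by apply: ub_le_sup; [exists (c 0 i)|exists c].
Qed.

Definition equal_problem S := problem S /\ forall i j, best S i = best S j.

(** A solution is a total function on sets; only its values at problems are
    constrained or used. *)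
Definition bargaining_solution (F : set 'rV[R]_n -> set 'rV[R]_n) :=
  forall S, problem S -> F S !=set0 /\ F S `<=` S.

Section Conditions.
Variable F : set 'rV[R]_n -> set 'rV[R]_n.

Definition intermediate_pareto := forall S, problem S ->
  (forall x, F S x -> ~ exists2 y, S y & vltall x y) /\
  (exists2 x, F S x & ~ exists2 y, S y & vlt x y).

Definition scale_invariance := forall S a, problem S -> vltall 0 a ->
  F (vmul a @` S) = vmul a @` F S.

Definition anonymity := forall S, problem S -> symmetric_set S ->
  forall x, F S x -> forall p : 'S_n, F S (col_perm p x).

Definition continuity :=
  forall (S : hyperspace 'rV[R]_n) (x : 'rV[R]_n), problem S -> S x ->
  (exists (Sk : nat -> hyperspace 'rV[R]_n) (xk : nat -> 'rV[R]_n),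
     [/\ forall k, problem (Sk k), forall k, F (Sk k) (xk k),
         Sk @ \oo --> S & xk @ \oo --> x]) ->
  F S x.

Definition weak_IIA := forall S S', equal_problem S -> equal_problem S' ->
  S' `<=` S -> S' `&` F S !=set0 -> F S' = S' `&` F S.

Definition independence_of_timing := forall S x (m : nat),
  problem S -> S x -> (0 < m)%N -> F S x <-> F (vpow m @` S) (vpow m x).

End Conditions.

Definition weights : set 'rV[R]_n :=
  [set w | orthant w /\ \sum_i w 0 i = 1].

Definition symmetric_collection (WW : set (set 'rV[R]_n)) :=
  forall W, WW W -> forall p : 'S_n, WW (col_perm p @` W).

Definition wgeomean w y : R := \prod_i y 0 i `^ w 0 i.

(** [V] is the max-min of weighted geometric means on the positive orthant,
    extended continuously to the nonnegative orthant. By density [V] is unique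
    on the nonnegative orthant, and its values elsewhere are irrelevant. *)
Definition maxmin_geomean (WW : set (set 'rV[R]_n)) (V : 'rV[R]_n -> R) :=
  (forall y, pos_orthant y ->
     is_max [set v | exists2 W, WW W & is_min [set wgeomean w y | w in W] v]
            (V y)) /\
  {within orthant, continuous V}.

Definition normalize S x : 'rV[R]_n := \row_i (x 0 i / best S i).

End Bargaining.

(* Main.v *)
(** A problem all of whose coordinates have the same maximum stays so under
    unions, so by weak IIA a solution maximizes, on such problems, the complete
    preorder "chosen from some such problem containing the other point". It is
    complete because the comprehensive hull of all permutations of two points
    is symmetric and its strictly Pareto optimal points are permutations of
    those two. Continuity, scale invariance and independence of timing turn it
    into a value [V] that is monotone, homogeneous and commutes with powers, so
    that [g u = ln (V (exp u))] is monotone, translation equivariant and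
    positively homogeneous.

    Such a [g] is a max-min of weighted means. If [g z = 0], the set of weights
    [w] with [<w, z> >= 0] is the convex hull of at most [n ^ 2] points on the
    edges of the simplex, and by duality its minimum of [<w, u>] is at most
    [g u] for every [u]. Taking all convex hulls of [n ^ 2] weights with this
    last property gives a compact collection, as the image of a compact set of
    stochastic matrices under a continuous map. *)

Require Import Defs.
From mathcomp Require Import ring lra.

Set Implicit Arguments.
Unset Strict Implicit.
Unset Printing Implicit Defensive.

Local Open Scope classical_set_scope.
Local Open Scope ring_scope.

(** * Vectors, transport of problems along coordinatewise maps, and symmetric hulls *)

Section Vectors.
Variables (R : realType) (n : nat).
Implicit Types (a w x y z : 'rV[R]_n) (S : set 'rV[R]_n) (i j : 'I_n) (t c e : R).

Lemma rV_ballP x y e :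
  ball x e y <-> 0 < e /\ forall i, `|x 0 i - y 0 i| < e.
Proof.
split=> [[e0 h]|[e0 h]]; split=> // i; first exact: (h 0 i).
by move=> j; rewrite (ord1 i); exact: h.
Qed.

Lemma cvg_rV (T : Type) (G : set_system T) {FG : Filter G} (f : T -> 'rV[R]_n) x :
  (forall i, (fun p => f p 0 i) @ G --> x 0 i) -> f @ G --> x.
Proof.
move=> cf; apply/cvg_ballP => e e0.
have : G [set p | forall i, ball (x 0 i) e (f p 0 i)].
  apply: (@filter_forall T 'I_n (fun i p => ball (x 0 i) e (f p 0 i)) G _) => i.
  by move/cvg_ballP: (cf i); exact.
by apply: filterS => y h; apply/rV_ballP; split.
Qed.

Lemma rV_continuous (T : topologicalType) (f : T -> 'rV[R]_n) :
  (forall i, continuous (fun p : T => f p 0 i)) -> continuous f.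
Proof. by move=> cf p; apply: cvg_rV => i; exact: cf. Qed.

Lemma within_cvg_seq (D : set 'rV[R]_n) (f : 'rV[R]_n -> R)
    (u : nat -> 'rV[R]_n) x :
  {within D, continuous f} -> (forall k, D (u k)) -> D x ->
  u @ \oo --> x -> (fun k => f (u k)) @ \oo --> f x.
Proof.
move=> /subspace_continuousP cf Du Dx ux.
apply: (@cvg_comp _ _ _ u f _ (within D (nbhs x))); last exact: cf.
move=> A wA.
have h : \forall k \near \oo, D (u k) -> A (u k) by exact: (ux _ wA).
by apply: filterS h => k; apply; exact: Du.
Qed.

Lemma vle_refl x : vle x x. Proof. by move=> i. Qed.

Lemma vle_trans x y z : vle x y -> vle y z -> vle x z.
Proof. by move=> xy yz i; exact: le_trans (xy i) (yz i). Qed.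

Lemma vle_anti x y : vle x y -> vle y x -> x = y.
Proof.
by move=> xy yx; apply/rowP => i; apply: le_anti; rewrite (xy i) (yx i).
Qed.

Lemma orthant_ge0 x i : orthant x -> 0 <= x 0 i.
Proof. by move/(_ i); rewrite mxE. Qed.

Lemma orthantP x : (forall i, 0 <= x 0 i) -> orthant x.
Proof. by move=> h i; rewrite mxE. Qed.

Lemma orthant_pos x : pos_orthant x -> orthant x.
Proof. by move=> h i; exact: ltW. Qed.

Lemma orthant_const t : 0 <= t -> orthant (const_mx t : 'rV[R]_n).
Proof. by move=> t0; apply: orthantP => i; rewrite mxE. Qed.

Lemma orthant_perm x (p : 'S_n) : orthant x -> orthant (col_perm p x).
Proof. by move=> x0; apply: orthantP => i; rewrite mxE orthant_ge0. Qed.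

Lemma orthant_neq0 x : orthant x -> x != 0 -> exists i, 0 < x 0 i.
Proof.
move=> x0; apply: contraNP => h; apply/eqP/rowP => i; rewrite mxE.
apply: le_anti; rewrite orthant_ge0 // andbT leNgt; apply/negP => xi.
by apply: h; exists i.
Qed.

Lemma col_permK (p : 'S_n) x : col_perm p^-1 (col_perm p x) = x.
Proof. by apply/rowP => i; rewrite !mxE permKV. Qed.

Lemma col_permKV (p : 'S_n) x : col_perm p (col_perm p^-1 x) = x.
Proof. by apply/rowP => i; rewrite !mxE permK. Qed.

Lemma bestE S i t : is_max [set x 0 i | x in S] t -> best S i = t.
Proof.
move=> [At ubt]; apply: le_anti; rewrite ge_sup ?ub_le_sup //.
  by exists t.
by exists t.
Qed.

Lemma le_best S i x : problem S -> S x -> x 0 i <= best S i.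
Proof. by move=> pS Sx; have [_] := bestP i pS; apply; exists x. Qed.

Lemma best_attained S i : problem S -> exists2 x, S x & x 0 i = best S i.
Proof. by move=> pS; have [] := bestP i pS. Qed.

Lemma best_gt0 S i : problem S -> 0 < best S i.
Proof.
move=> pS; have [_ _ _ _ /(_ i)[x Sx x0]] := pS.
exact: lt_le_trans x0 (le_best i pS Sx).
Qed.

(** A common form of [vmul] and [vpow], so that problems and their maxima are transported along both
    by one argument. *)
Definition vmap (f : 'I_n -> R -> R) x : 'rV[R]_n := \row_i f i (x 0 i).

Section Vmap.
Variables (f g : 'I_n -> R -> R).
Hypothesis f_cts : forall i, continuous (f i).
Hypothesis f0 : forall i, f i 0 = 0.
Hypothesis f_lt : forall i s t, 0 <= s -> s < t -> f i s < f i t.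
Hypothesis g_ge0 : forall i t, 0 <= t -> 0 <= g i t.
Hypothesis gK : forall i t, 0 <= t -> f i (g i t) = t.

Let f_le i s t : 0 <= s -> s <= t -> f i s <= f i t.
Proof. by move=> s0; rewrite le_eqVlt => /predU1P[->//|/(f_lt i s0)/ltW]. Qed.

Let f_ge0 i t : 0 <= t -> 0 <= f i t.
Proof. by move=> t0; rewrite -(f0 i); exact: f_le. Qed.

Lemma vmap_continuous : continuous (vmap f).
Proof.
apply: rV_continuous => i.
rewrite (_ : (fun x => _) = (fun x : 'rV[R]_n => f i (x 0 i))).
  by move=> x; apply: continuous_comp; [exact: coord_continuous|exact: f_cts].
by apply/funext => x; rewrite mxE.
Qed.

Lemma problem_vmap S : problem S -> problem (vmap f @` S).
Proof.
move=> [[s Ss] S0 cS hS pS]; split.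
- by exists (vmap f s), s.
- move=> _ [x /S0 x0 <-]; apply: orthantP => i.
  by rewrite mxE f_ge0 ?orthant_ge0.
- apply: continuous_compact => //.
  by apply: continuous_subspaceT; exact: vmap_continuous.
(* Comprehensiveness is pulled back along the right inverse [g]: a coordinate of [vmap g y] above
   that of [x] would, by strict monotonicity of [f], put [y] above [vmap f x] there. *)
- move=> _ y _ y0 [x Sx <-] xy; exists (vmap g y).
    have gy0 : orthant (vmap g y).
      by apply: orthantP => i; rewrite mxE g_ge0 ?orthant_ge0.
    apply: (hS x) => //; first exact: S0.
    move=> i; rewrite mxE leNgt; apply/negP => /(f_lt i (orthant_ge0 i (S0 _ Sx))).
    by rewrite gK ?orthant_ge0 // ltNge; have := xy i; rewrite mxE => ->.
  by apply/rowP => i; rewrite !mxE gK ?orthant_ge0.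
- move=> i; have [x Sx xi] := pS i; exists (vmap f x); first by exists x.
  by rewrite mxE -[0 : R](f0 i) f_lt.
Qed.

Lemma best_vmap S i : problem S -> best (vmap f @` S) i = f i (best S i).
Proof.
move=> pS; apply: bestE; split.
  have [x Sx <-] := best_attained i pS.
  by exists (vmap f x); [exists x|rewrite mxE].
move=> _ [_ [x Sx <-] <-]; rewrite mxE f_le ?le_best //.
by rewrite orthant_ge0 //; have [_ + _ _ _] := pS; exact.
Qed.

End Vmap.

Lemma vmulE a x : vmul a x = vmap (fun i t => a 0 i * t) x.
Proof. by apply/rowP => i; rewrite !mxE. Qed.

Lemma vpowE m x : vpow m x = vmap (fun i t => t ^+ m) x.
Proof. by apply/rowP => i; rewrite !mxE. Qed.

Section Vmul.
Variable a : 'rV[R]_n.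
Hypothesis a0 : vltall 0 a.

Let a_gt0 i : 0 < a 0 i. Proof. by have := a0 i; rewrite mxE. Qed.

Lemma problem_vmul S : problem S -> problem (vmul a @` S).
Proof.
rewrite (_ : vmul a = vmap (fun i t => a 0 i * t)); last first.
  by apply/funext => x; exact: vmulE.
apply: (@problem_vmap _ (fun i t => (a 0 i)^-1 * t)).
- by move=> i t; apply: cvgM; [exact: cvg_cst|exact: cvg_id].
- by move=> i; rewrite mulr0.
- by move=> i s t _; rewrite ltr_pM2l.
- by move=> i t t0; rewrite mulr_ge0 // invr_ge0 ltW.
- by move=> i t _; rewrite mulVKf // gt_eqF.
Qed.

Lemma best_vmul S i : problem S -> best (vmul a @` S) i = a 0 i * best S i.
Proof.
rewrite (_ : vmul a = vmap (fun i t => a 0 i * t)); last first.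
  by apply/funext => x; exact: vmulE.
apply: (@best_vmap) => // j s t _; by rewrite ltr_pM2l.
Qed.

End Vmul.

Section Vpow.
Variable m : nat.
Hypothesis m0 : (0 < m)%N.

Let ltrX s t : 0 <= s -> s < t -> s ^+ m < t ^+ m.
Proof. by move=> s0 st; rewrite ltrXn2r // -lt0n. Qed.

Lemma problem_vpow S : problem S -> problem (vpow m @` S).
Proof.
rewrite (_ : vpow m = vmap (fun i t => t ^+ m)); last first.
  by apply/funext => x; exact: vpowE.
apply: (@problem_vmap _ (fun i t => t `^ m%:R^-1)).
- by move=> i; exact: exprn_continuous.
- by move=> i; rewrite expr0n eqn0Ngt m0.
- by move=> i s t; exact: ltrX.
- by move=> i t t0; exact: powR_ge0.
- move=> i t t0; rewrite -powR_mulrn ?powR_ge0 // -powRrM mulVf ?powRr1 //.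
  by rewrite pnatr_eq0 -lt0n.
Qed.

Lemma best_vpow S i : problem S -> best (vpow m @` S) i = best S i ^+ m.
Proof.
rewrite (_ : vpow m = vmap (fun i t => t ^+ m)); last first.
  by apply/funext => x; exact: vpowE.
apply: best_vmap => j s t; exact: ltrX.
Qed.

End Vpow.

Lemma best_setU S S' i : problem S -> problem S' ->
  best (S `|` S') i = Num.max (best S i) (best S' i).
Proof.
move=> pS pS'; apply: bestE; split.
  have [x Sx xb] := best_attained i pS; have [y Sy yb] := best_attained i pS'.
  by case: leP => _; [exists y => //; right|exists x => //; left].
by move=> _ [x [Sx|Sx] <-]; rewrite le_max; apply/orP; [left|right];
  exact: le_best.
Qed.

Lemma problem_setU S S' : problem S -> problem S' -> problem (S `|` S').
Proof.
move=> [[s Ss] S0 cS hS pS] [_ S0' cS' hS' _]; split.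
- by exists s; left.
- by move=> x [/S0|/S0'].
- exact: compactU.
- move=> x y x0 y0 [Sx|Sx] yx; [left|right]; first exact: (hS x).
  exact: (hS' x).
- by move=> i; have [x Sx] := pS i; exists x => //; left.
Qed.

Lemma equal_problem_setU S S' :
  equal_problem S -> equal_problem S' -> equal_problem (S `|` S').
Proof.
move=> [pS eS] [pS' eS']; split; first exact: problem_setU.
by move=> i j; rewrite !best_setU // (eS i j) (eS' i j).
Qed.

(** The transposition of [i] and [j] maps [S] onto itself and exchanges the two coordinates. *)
Lemma symmetric_equal_problem S :
  problem S -> symmetric_set S -> equal_problem S.
Proof.
move=> pS sS; split=> // i j; rewrite /best; congr (sup _).
rewrite [in LHS](sS (tperm i j)); apply/seteqP; split=> [_ [_ [x Sx <-] <-]|].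
  by exists x => //; rewrite mxE tpermL.
move=> _ [x Sx <-]; exists (col_perm (tperm i j) x); first by exists x.
by rewrite mxE tpermL.
Qed.

(** For [x] in the orthant, this is the comprehensive hull of all permutations of [x]. *)
Definition sym_hull x : set 'rV[R]_n :=
  [set y | orthant y /\ exists p : 'S_n, vle y (col_perm p x)].

Lemma sym_hull_le x y : orthant y -> vle y x -> sym_hull x y.
Proof.
by move=> y0 yx; split=> //; exists 1%g; rewrite col_perm1.
Qed.

Lemma sym_hull_perm x (p : 'S_n) : orthant x -> sym_hull x (col_perm p x).
Proof. by move=> x0; split; [exact: orthant_perm|exists p]. Qed.

Lemma sym_hull_refl x : orthant x -> sym_hull x x.
Proof. by move=> x0; apply: sym_hull_le. Qed.

(** The hull is a finite union, over the permutations, of boxes that are products of segments. *)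
Lemma compact_sym_hull x : compact (sym_hull x).
Proof.
pose B (p : 'S_n) :=
  [set y : 'rV[R]_n | forall i, `[0, col_perm p x 0 i]%classic (y 0 i)].
have -> : sym_hull x = \big[setU/set0]_(p <- enum 'S_n) B p.
  rewrite -bigcup_seq; apply/seteqP; split=> [y [y0 [p yp]]|y [p _ yp]].
    exists p; first by rewrite /= mem_enum.
    by move=> i; rewrite /= in_itv /= yp orthant_ge0.
  split; last by exists p => i; have := yp i; rewrite /= in_itv => /andP[].
  by apply: orthantP => i; have := yp i; rewrite /= in_itv => /andP[].
apply: bigsetU_compact => p _.
apply: (@rV_compact _ _ (fun i => `[0, col_perm p x 0 i]%classic)) => i.
exact: segment_compact.
Qed.

(** Truncating [z] at the permutation of [x'] that matches the one bounding it by [x] costs less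
    than [e] in each coordinate. This makes hulls depend continuously on their generators. *)
Lemma sym_hull_ball x x' z e : orthant x' -> ball x e x' -> sym_hull x z ->
  exists2 z', sym_hull x' z' & ball z e z'.
Proof.
move=> x'0 /rV_ballP[e0 xx'] [z0 [p zp]].
exists (\row_i Num.min (z 0 i) (x' 0 (p i))).
  split; last by exists p => i; rewrite !mxE ge_min lexx orbT.
  by apply: orthantP => i; rewrite mxE le_min !orthant_ge0.
apply/rV_ballP; split=> // i; rewrite mxE.
have := zp i; have := xx' (p i); rewrite mxE.
case: (leP (z 0 i) (x' 0 (p i))) => h; first by rewrite subrr normr0.
by rewrite !ltr_norml => /andP[? ?] ?; lra.
Qed.

Lemma symmetric_sym_hull x : symmetric_set (sym_hull x).
Proof.
have sub (q : 'S_n) y : sym_hull x y -> sym_hull x (col_perm q y).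
  move=> [y0 [p yp]]; split; first exact: orthant_perm.
  by exists (q * p)%g => i; rewrite !mxE permM; have := yp (q i); rewrite mxE.
move=> q; apply/seteqP; split=> [y xy|_ [y xy <-]]; last exact: sub.
by exists (col_perm q^-1 y); [exact: sub|rewrite col_permKV].
Qed.

Definition hull2 x y := sym_hull x `|` sym_hull y.

Lemma hull2l x y : orthant x -> hull2 x y x.
Proof. by move=> x0; left; exact: sym_hull_refl. Qed.

Lemma hull2r x y : orthant y -> hull2 x y y.
Proof. by move=> y0; right; exact: sym_hull_refl. Qed.

Lemma symmetric_hull2 x y : symmetric_set (hull2 x y).
Proof. by move=> p; rewrite /hull2 image_setU -!symmetric_sym_hull. Qed.

Lemma problem_hull2 x y :
  orthant x -> orthant y -> x != 0 \/ y != 0 -> problem (hull2 x y).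
Proof.
move=> x0 y0 xy; split.
- by exists x; exact: hull2l.
- by move=> z [] [].
- by apply: compactU; exact: compact_sym_hull.
- by move=> u v _ v0 [] [_ [p up]] vu; [left|right]; split=> //;
    exists p; exact: vle_trans up.
(* A transposition carries a positive coordinate [j] to the required position [i]. *)
- move=> i; case: xy => /orthant_neq0 [//|j j0].
    exists (col_perm (tperm i j) x); last by rewrite mxE tpermL.
    by left; exact: sym_hull_perm.
  exists (col_perm (tperm i j) y); last by rewrite mxE tpermL.
  by right; exact: sym_hull_perm.
Qed.

Lemma equal_problem_hull2 x y :
  orthant x -> orthant y -> x != 0 \/ y != 0 -> equal_problem (hull2 x y).
Proof.
by move=> *; apply: symmetric_equal_problem;
  [exact: problem_hull2|exact: symmetric_hull2].
Qed.

Lemma hausdorff_hull2 x y x' y' e : orthant x -> orthant y ->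
  orthant x' -> orthant y' -> ball x e x' -> ball y e y' ->
  hausdorff_ball (hull2 x y : hyperspace _) e (hull2 x' y').
Proof.
move=> x0 y0 x'0 y'0 xx' yy'; split=> z [zh|zh].
- by have [z' ? ?] := sym_hull_ball x'0 xx' zh; exists z' => //; left.
- by have [z' ? ?] := sym_hull_ball y'0 yy' zh; exists z' => //; right.
- have [z' ? ?] := sym_hull_ball x0 (ball_sym xx') zh.
  by exists z' => //; left.
- have [z' ? ?] := sym_hull_ball y0 (ball_sym yy') zh.
  by exists z' => //; right.
Qed.

Lemma cvg_hull2 (u v : nat -> 'rV[R]_n) x y : orthant x -> orthant y ->
  (forall k, orthant (u k)) -> (forall k, orthant (v k)) ->
  u @ \oo --> x -> v @ \oo --> y ->
  (fun k => hull2 (u k) (v k) : hyperspace 'rV[R]_n) @ \oo -->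
    (hull2 x y : hyperspace 'rV[R]_n).
Proof.
move=> x0 y0 u0 v0 /cvg_ballP ux /cvg_ballP vy; apply/cvg_ballP => e e0.
have := ux e e0; have := vy e e0; apply: filterS2 => k vk uk.
exact: hausdorff_hull2.
Qed.

End Vectors.

(** * Neighbourhoods tested by sequences *)

Section Sequences.
Variables (R : realType) (n : nat).
Implicit Types (x : 'rV[R]_n) (D P : set 'rV[R]_n).

(** If [P] failed in [D] arbitrarily near [x], failing points in the balls of radius [1/(k+1)] would
    form a forbidden sequence. This turns the sequential closedness of [pref] into continuity of
    [value]. *)
Lemma near_within_seq D P x :
  (forall u : nat -> 'rV[R]_n, (forall k, D (u k)) -> u @ \oo --> x ->
     exists k, P (u k)) ->
  \forall y \near within D (nbhs x), P y.
Proof.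
move=> h; apply: contrapT => nP.
have ex k : exists y, [/\ ball x (k.+1%:R^-1 : R) y, D y & ~ P y].
  apply: contra_notP nP => nex; apply/nbhs_ballP.
  exists (k.+1%:R^-1) => //= y xy Dy; apply: contrapT => nPy.
  by apply: nex; exists y.
have [u uP] := choice ex.
have [|k] := h u (fun k => let: And3 _ d _ := uP k in d); last first.
  by have [] := uP k.
apply/cvg_ballP => e e0.
have := @cvg_harmonic R; move/cvgr_lt/(_ e e0); apply: filterS => k ke.
by have [+ _ _] := uP k; apply: le_ball; exact: ltW.
Qed.

Lemma cvg_const_mx (t : nat -> R) (l : R) : t @ \oo --> l ->
  (fun k => const_mx (t k) : 'rV[R]_n) @ \oo --> (const_mx l : 'rV[R]_n).
Proof.
move=> tl; apply: cvg_rV => i; rewrite mxE.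
by rewrite (_ : (fun k => _) = t) //; apply/funext => k; rewrite mxE.
Qed.

End Sequences.

(** * The revealed preference of a solution satisfying the axioms, and its numerical value *)

Section Preference.
Variables (R : realType) (n : nat) (i0 : 'I_n).
Variable F : set 'rV[R]_n -> set 'rV[R]_n.
Hypothesis F_sol : bargaining_solution F.
Hypothesis F_pareto : intermediate_pareto F.
Hypothesis F_scale : scale_invariance F.
Hypothesis F_anon : anonymity F.
Hypothesis F_cont : continuity F.
Hypothesis F_IIA : weak_IIA F.
Hypothesis F_timing : independence_of_timing F.
Implicit Types (x y z : 'rV[R]_n) (S T : set 'rV[R]_n) (i j : 'I_n) (t : R).

Let F_sub S x : problem S -> F S x -> S x.
Proof. by move=> /F_sol[_]; exact. Qed.

(** Revealed preference. Only equal problems serve as witnesses: weak IIA speaks of these alone, and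
    they are stable under unions. *)
Definition pref x y := exists S, [/\ equal_problem S, F S x & S y].

Let IIA_mem S U z x : equal_problem S -> equal_problem U -> S `<=` U ->
  S z -> F U z -> F S x <-> S x /\ F U x.
Proof.
by move=> eS eU SU Sz FUz; rewrite (F_IIA eU eS SU) //; exists z.
Qed.

(** Weak IIA is applied to the union of [S] and [T]. If something in [S] is chosen there, so is [x];
    if something in [T] is chosen, then so is [y], which lies in [S], and hence [x]. Restricting to
    [T] concludes. *)
Lemma pref_F T x y : pref x y -> equal_problem T -> F T y -> T x -> F T x.
Proof.
move=> [S [eS FSx Sy]] eT FTy Tx.
have eU := equal_problem_setU eS eT.
have Sx : S x by apply: F_sub FSx; case: eS.
have Ty : T y by apply: F_sub FTy; case: eT.
have FS z := IIA_mem z eS eU (@subsetUl _ S T).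
have FT z := IIA_mem z eT eU (@subsetUr _ S T).
suff FUx : F (S `|` T) x by apply/(FT _ x Tx FUx).
have [[z FUz] sub] := F_sol eU.1; case: (sub _ FUz) => [Sz|Tz].
  by have [] := (FS _ x Sz FUz).1 FSx.
have [_ FUy] := (FT _ y Tz FUz).1 FTy.
by have [] := (FS _ x Sy FUy).1 FSx.
Qed.

Lemma pref_trans x y z : pref x y -> pref y z -> pref x z.
Proof.
move=> pxy [T [eT FTy Tz]]; have [S [eS FSx Sy]] := pxy.
have eU := equal_problem_setU eS eT; exists (S `|` T); split=> //; last by right.
have Sx : S x by apply: F_sub FSx; case: eS.
have [[v FUv] sub] := F_sol eU.1; case: (sub _ FUv) => [Sv|Tv].
  by have [] := (IIA_mem x eS eU (@subsetUl _ S T) Sv FUv).1 FSx.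
have [_ FUy] := (IIA_mem y eT eU (@subsetUr _ S T) Tv FUv).1 FTy.
by apply: (pref_F pxy) => //; left.
Qed.

(** Intermediate Pareto provides an undominated choice [z]. It lies below a permutation of [x] or
    [y] that is itself in the hull, hence equals it, and anonymity undoes the permutation. *)
Lemma hull2_optimal x y : orthant x -> orthant y -> x != 0 \/ y != 0 ->
  F (hull2 x y) x \/ F (hull2 x y) y.
Proof.
move=> x0 y0 xy; have pH := problem_hull2 x0 y0 xy.
have [_ [z Fz zmax]] := F_pareto pH.
have opt v (p : 'S_n) : hull2 x y (col_perm p v) -> vle z (col_perm p v) ->
    F (hull2 x y) v.
  move=> Hv zv; rewrite -(col_permK p v).
  apply: F_anon => //; first exact: symmetric_hull2.
  suff <- : z = col_perm p v by [].
  by apply: contrapT => zNv; apply: zmax; exists (col_perm p v).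
have [[_ [p zp]]|[_ [p zp]]] := F_sub pH Fz.
  by left; apply: (opt _ p) => //; left; exact: sym_hull_perm.
by right; apply: (opt _ p) => //; right; exact: sym_hull_perm.
Qed.

Lemma pref_total x y : orthant x -> orthant y -> x != 0 \/ y != 0 ->
  pref x y \/ pref y x.
Proof.
move=> x0 y0 xy; have eH := equal_problem_hull2 x0 y0 xy.
by have [?|?] := hull2_optimal x0 y0 xy; [left|right]; exists (hull2 x y);
  split=> //; [exact: hull2r|exact: hull2l].
Qed.

(** Every comparison is witnessed by the canonical problem [hull2 x y], which varies continuously
    with the two points; this is what makes limits of comparisons tractable. *)
Lemma pref_hull2 x y : orthant x -> orthant y -> x != 0 \/ y != 0 ->
  pref x y -> F (hull2 x y) x.
Proof.
move=> x0 y0 xy pxy; have eH := equal_problem_hull2 x0 y0 xy.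
have [//|Fy] := hull2_optimal x0 y0 xy.
by apply: (pref_F pxy) => //; exact: hull2l.
Qed.

Let F_hull x : orthant x -> x != 0 -> F (hull2 x x) x.
Proof. by move=> x0 xn0; case: (@hull2_optimal x x) => //; left. Qed.

Lemma pref_le x y : orthant x -> x != 0 -> orthant y -> vle y x -> pref x y.
Proof.
move=> x0 xn0 y0 yx; exists (hull2 x x); split; last by left; exact: sym_hull_le.
  by apply: equal_problem_hull2 => //; left.
exact: F_hull.
Qed.

Lemma pref_lt x y : vltall y x -> ~ pref y x.
Proof.
move=> yx [S [[pS _] FSy Sx]]; have [+ _] := F_pareto pS.
by move/(_ _ FSy); apply; exists x.
Qed.

Lemma pref_perm x (p : 'S_n) : orthant x -> x != 0 ->
  pref x (col_perm p x) /\ pref (col_perm p x) x.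
Proof.
move=> x0 xn0; have eH : equal_problem (hull2 x x).
  by apply: equal_problem_hull2 => //; left.
split; exists (hull2 x x); split=> //.
- exact: F_hull.
- by left; exact: sym_hull_perm.
- apply: F_anon => //; [by case: eH|exact: symmetric_hull2|exact: F_hull].
- exact: hull2l.
Qed.

(** The canonical witnesses [hull2 (u k) (v k)] converge to [hull2 x y] in the Hausdorff topology,
    so continuity of [F] applies. *)
Lemma pref_closed (u v : nat -> 'rV[R]_n) x y : orthant x -> orthant y ->
  (forall k, orthant (u k)) -> (forall k, orthant (v k)) ->
  x != 0 \/ y != 0 -> (forall k, u k != 0 \/ v k != 0) ->
  u @ \oo --> x -> v @ \oo --> y -> (forall k, pref (u k) (v k)) -> pref x y.
Proof.
move=> x0 y0 u0 v0 xy uv ux vy puv; have eH := equal_problem_hull2 x0 y0 xy.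
exists (hull2 x y); split=> //; last exact: hull2r.
apply: F_cont; [by case: eH|exact: hull2l|].
exists (fun k => hull2 (u k) (v k)), u; split=> //.
- by move=> k; exact: problem_hull2.
- by move=> k; apply: pref_hull2.
- exact: cvg_hull2.
Qed.

Lemma pref_image x y (f : 'rV[R]_n -> 'rV[R]_n) :
  (forall S, equal_problem S -> equal_problem (f @` S)) ->
  (forall S z, equal_problem S -> F S z -> F (f @` S) (f z)) ->
  pref x y -> pref (f x) (f y).
Proof.
move=> fE fF [S [eS FSx Sy]]; exists (f @` S); split; [exact: fE|exact: fF|].
by exists y.
Qed.

Lemma pref_scale (l : R) x y : 0 < l ->
  pref x y -> pref (vmul (const_mx l) x) (vmul (const_mx l) y).
Proof.
move=> l0; have lv : vltall 0 (const_mx l : 'rV[R]_n) by move=> i; rewrite !mxE.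
apply: pref_image => S => [[pS eS]|z [pS eS] FSz].
  split; first exact: problem_vmul.
  by move=> i j; rewrite !best_vmul // !mxE (eS i j).
by rewrite F_scale //; exists z.
Qed.

Lemma pref_vpow m x y : (0 < m)%N -> pref x y -> pref (vpow m x) (vpow m y).
Proof.
move=> m0; apply: pref_image => S => [[pS eS]|z [pS eS] FSz].
  split; first exact: problem_vpow.
  by move=> i j; rewrite !best_vpow // (eS i j).
exact: (F_timing pS (F_sub pS FSz) m0).1.
Qed.

(** The level of the constant vector indifferent to [x], when [x] is a nonzero point of the orthant;
    see [value_spec]. *)
Definition value x : R := sup [set t | 0 <= t /\ pref x (const_mx t)].

Notation cst t := (const_mx t : 'rV[R]_n).

Lemma const_mx_neq0 t : t != 0 -> cst t != 0.
Proof. by apply: contraNneq => /rowP/(_ i0); rewrite !mxE => ->. Qed.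

Lemma const_mx0 : cst 0 = 0. Proof. by apply/rowP => i; rewrite !mxE. Qed.

Lemma vltall_const s t : s < t -> vltall (cst s) (cst t).
Proof. by move=> st i; rewrite !mxE. Qed.

Lemma value0 : value 0 = 0.
Proof.
have sub : [set t | 0 <= t /\ pref 0 (cst t)] `<=` [set 0].
  move=> t [t0 pt] /=; apply: le_anti; rewrite t0 andbT leNgt; apply/negP => tp.
  by apply: pref_lt pt; rewrite -const_mx0; exact: vltall_const.
(* The set of levels may be empty, and then the supremum is 0 by default. *)
by rewrite /value; have [->|->] := subset_set1 sub; rewrite ?sup0 ?sup1.
Qed.

Lemma value_spec x : orthant x -> x != 0 ->
  [/\ 0 <= value x, pref x (cst (value x)) & pref (cst (value x)) x].
Proof.
move=> x0 xn0; pose A := [set t | 0 <= t /\ pref x (cst t)].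
have A0 : A 0.
  split=> //; rewrite const_mx0; exact: pref_le.
have ubA : has_ubound A.
  (* A constant vector above the coordinate sum strictly dominates [x]. *)
  exists (\sum_i x 0 i) => t [t0 pt]; rewrite leNgt; apply/negP => st.
  apply: pref_lt pt => i; rewrite mxE; apply: le_lt_trans st.
  rewrite (bigD1 i) //= lerDl sumr_ge0 // => j _; exact: orthant_ge0.
have v0 : 0 <= value x by exact: ub_le_sup.
have ov t : 0 <= t -> orthant (cst t) by exact: orthant_const.
have cx : (fun _ : nat => x) @ \oo --> x by exact: cvg_cst.
have hv : (value x + k.+1%:R^-1) @[k --> \oo] --> value x.
  by rewrite -[X in _ --> X]addr0; apply: cvgD; [exact: cvg_cst|exact: cvg_harmonic].
split=> //.
  (* From below: levels in [A] tending to the supremum, and closedness of [pref]. *)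
  have ex k : exists t, A t /\ value x - k.+1%:R^-1 < t.
    have hA : has_sup A by split=> //; exists 0.
    have [|t At lt] := @sup_adherent _ A (k.+1%:R^-1) _ hA.
      by rewrite invr_gt0.
    by exists t.
  have [t tP] := choice ex.
  apply: (@pref_closed (fun=> x) (fun k => cst (t k))) => //.
  - exact: ov.
  - by move=> k; have [[t0 _] _] := tP k; exact: ov.
  - by left.
  - by left.
  - apply: cvg_const_mx.
    apply: (@squeeze_cvgr _ _ _ _ (fun k => value x - k.+1%:R^-1) (fun=> value x)).
    + apply: nearW => k; have [At lt] := tP k.
      by rewrite (ltW lt) ub_le_sup.
    + rewrite -[X in _ --> X]subr0; apply: cvgB; first exact: cvg_cst.
      exact: cvg_harmonic.
    + exact: cvg_cst.
  - by move=> k; have [[]] := tP k.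
(* From above: a level beyond the supremum is outside [A], so totality reverses the preference, and
   closedness passes to the limit. *)
apply: (@pref_closed (fun k => cst (value x + k.+1%:R^-1)) (fun=> x)) => //.
- exact: ov.
- by move=> k; apply: ov; rewrite addr_ge0.
- by right.
- by right.
- exact: cvg_const_mx.
- move=> k; have t0 : 0 <= value x + k.+1%:R^-1 by rewrite addr_ge0.
  have [//|pt] := pref_total (ov _ t0) x0 (or_intror xn0).
  have : value x + k.+1%:R^-1 <= value x by apply: ub_le_sup.
  by rewrite gerDl leNgt invr_gt0 ltr0Sn.
Qed.

Lemma value_ge0 x : orthant x -> 0 <= value x.
Proof.
move=> x0; have [->|xn0] := eqVneq x 0; first by rewrite value0.
by have [] := value_spec x0 xn0.
Qed.

(** Constant vectors are ranked by their levels, so points are ranked by the levels indifferent to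
    them. The zero vector is treated apart because [value_spec] excludes it. *)
Lemma prefE x y : orthant x -> orthant y -> x != 0 \/ y != 0 ->
  pref x y <-> value y <= value x.
Proof.
move=> x0 y0 xy.
have [xE|xn0] := eqVneq x 0.
  have yn0 : y != 0 by case: xy => //; rewrite xE eqxx.
  have [v0 yv vy] := value_spec y0 yn0; rewrite xE value0.
  split=> [p0y|v0'].
    rewrite leNgt; apply/negP => /vltall_const; rewrite const_mx0.
    by move/pref_lt; apply; exact: pref_trans yv.
  suff <- : cst (value y) = 0 by [].
  by rewrite (_ : value y = 0) ?const_mx0 //; apply: le_anti; rewrite v0 v0'.
have [v0 xv vx] := value_spec x0 xn0.
have [yE|yn0] := eqVneq y 0.
  by rewrite yE value0; split=> // _; exact: pref_le.
have [w0 yw wy] := value_spec y0 yn0.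
split=> [pxy|].
  rewrite leNgt; apply/negP => /vltall_const /pref_lt; apply.
  exact: pref_trans vx (pref_trans pxy yw).
rewrite le_eqVlt => /predU1P[vE|lt].
  by apply: pref_trans xv _; rewrite -vE.
apply: pref_trans xv (pref_trans _ wy); apply: pref_le.
- exact: orthant_const.
- by apply: const_mx_neq0; rewrite gt_eqF // (le_lt_trans w0).
- exact: orthant_const.
- by move=> i; apply/ltW/vltall_const.
Qed.

Lemma value_const t : 0 <= t -> value (cst t) = t.
Proof.
rewrite le_eqVlt => /predU1P[<-|t0]; first by rewrite const_mx0 value0.
have [v0 tv vt] := value_spec (@orthant_const _ n _ (ltW t0))
  (const_mx_neq0 (lt0r_neq0 t0)).
apply: le_anti; rewrite !leNgt; apply/andP; split; apply/negP => /vltall_const.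
  by move/pref_lt; apply.
by move/pref_lt; apply.
Qed.

Lemma value_unique x t : orthant x -> x != 0 -> 0 <= t ->
  pref x (cst t) -> pref (cst t) x -> value x = t.
Proof.
move=> x0 xn0 t0; have ot := @orthant_const _ n _ t0.
move=> /prefE - /(_ x0 ot (or_introl xn0)) h1.
move=> /prefE - /(_ ot x0 (or_intror xn0)) h2.
by rewrite value_const // in h1 h2; apply: le_anti; rewrite h1 h2.
Qed.

Lemma value_mono x y : orthant x -> orthant y -> vle x y -> value x <= value y.
Proof.
move=> x0 y0 xy; have [->|xn0] := eqVneq x 0.
  by rewrite value0 value_ge0.
have yn0 : y != 0.
  apply: contra_neq xn0 => yE; apply: vle_anti => //; by rewrite -yE.
by apply/prefE => //; [left|exact: pref_le].
Qed.

(** Scaling preserves the indifference of [x] with its constant vector and sends constant vectors to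
    constant vectors. The same argument with powers gives [value_vpow]. *)
Lemma value_scale (l : R) x : 0 < l -> orthant x ->
  value (vmul (const_mx l) x) = l * value x.
Proof.
move=> l0 x0; have [->|xn0] := eqVneq x 0.
  rewrite value0 mulr0 (_ : vmul _ _ = 0) ?value0 //.
  by apply/rowP => i; rewrite !mxE mulr0.
have [v0 xv vx] := value_spec x0 xn0.
have cE : cst (l * value x) = vmul (cst l) (cst (value x)).
  by apply/rowP => i; rewrite !mxE.
apply: value_unique; rewrite ?cE.
- by apply: orthantP => i; rewrite !mxE mulr_ge0 ?orthant_ge0 // ltW.
- apply: contra_neq xn0 => /rowP E; apply/rowP => i; have := E i.
  by rewrite !mxE => /eqP; rewrite mulf_eq0 gt_eqF //= => /eqP.
- by rewrite mulr_ge0 // ltW.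
- exact: pref_scale.
- exact: pref_scale.
Qed.

Lemma value_vpow m x : (0 < m)%N -> orthant x -> value (vpow m x) = value x ^+ m.
Proof.
move=> m0 x0; have [->|xn0] := eqVneq x 0.
  rewrite value0 expr0n eqn0Ngt m0 (_ : vpow _ _ = 0) ?value0 //.
  by apply/rowP => i; rewrite !mxE expr0n eqn0Ngt m0.
have [v0 xv vx] := value_spec x0 xn0.
have cE : cst (value x ^+ m) = vpow m (cst (value x)).
  by apply/rowP => i; rewrite !mxE.
apply: value_unique; rewrite ?cE.
- by apply: orthantP => i; rewrite !mxE exprn_ge0 ?orthant_ge0.
- apply: contra_neq xn0 => /rowP E; apply/rowP => i; have := E i.
  by rewrite !mxE => /eqP; rewrite expf_eq0 m0 /= => /eqP.
- by rewrite exprn_ge0.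
- exact: pref_vpow.
- exact: pref_vpow.
Qed.

Lemma value_perm x (p : 'S_n) : orthant x -> value (col_perm p x) = value x.
Proof.
move=> x0; have px0 := orthant_perm p x0; have [xE|xn0] := eqVneq x 0.
  by rewrite xE (_ : col_perm _ _ = 0) //; apply/rowP => i; rewrite !mxE.
have [h1 h2] := pref_perm p x0 xn0.
by apply: le_anti; rewrite ((prefE x0 px0 _).1 h1) ?((prefE px0 x0 _).1 h2) //;
  [right|left].
Qed.

Lemma value_continuous : {within @orthant R n, continuous value}.
Proof.
apply/subspace_continuousP => x x0; apply/cvgrPdist_lt => e e0.
have lower : \forall y \near within (@orthant R n) (nbhs x), value x - e < value y.
  apply: near_within_seq => u u0 ux; apply: contrapT => nex.
  have {}nex k : value (u k) <= value x - e.
    by rewrite leNgt; apply/negP => ?; apply: nex; exists k.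
  have h : 0 <= value x - e := le_trans (value_ge0 (u0 0%N)) (nex 0%N).
  (* The midpoint of [value x - e] and [value x] is positive even when [value x - e] is 0, so the
     constant vector [t] is nonzero, as [pref_closed] asks. *)
  pose t := value x - e / 2.
  have t0 : 0 < t by rewrite /t; lra.
  have tn0 := const_mx_neq0 (lt0r_neq0 t0).
  have ot := @orthant_const _ n _ (ltW t0).
  suff : pref (cst t) x.
    move/prefE => /(_ ot x0 (or_introl tn0)); rewrite (value_const (ltW t0)) /t.
    by lra.
  apply: (@pref_closed (fun=> cst t) u) => //; [by left|by left|exact: cvg_cst|].
  move=> k; apply/prefE => //; first by left.
  by rewrite (value_const (ltW t0)) (le_trans (nex k)) // /t; lra.
have upper : \forall y \near within (@orthant R n) (nbhs x), value y < value x + e.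
  apply: near_within_seq => u u0 ux; apply: contrapT => nex.
  have {}nex k : value x + e <= value (u k).
    by rewrite leNgt; apply/negP => ?; apply: nex; exists k.
  pose t := value x + e.
  have t0 : 0 < t by rewrite /t ltr_wpDl // value_ge0.
  have tn0 := const_mx_neq0 (lt0r_neq0 t0).
  have ot := @orthant_const _ n _ (ltW t0).
  suff : pref x (cst t).
    move/prefE => /(_ x0 ot (or_intror tn0)); rewrite (value_const (ltW t0)) /t.
    by lra.
  apply: (@pref_closed u (fun=> cst t)) => //; [by right|by right|exact: cvg_cst|].
  move=> k; apply/prefE => //; first by right.
  by rewrite (value_const (ltW t0)) nex.
apply: filterS2 lower upper => y h1 h2.
by rewrite ltr_distlC h1 h2.
Qed.

Lemma F_argmax_equal S : equal_problem S -> F S = argmax S value.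
Proof.
move=> eS; have [pS _] := eS; have [_ S0 _ _ _] := pS.
apply/seteqP; split=> x.
  move=> FSx; have Sx := F_sub pS FSx; split=> // y Sy.
  have pxy : pref x y by exists S.
  have [xE|xn0] := eqVneq x 0.
    have [->|yn0] := eqVneq y 0; first by rewrite xE.
    by apply: (prefE _ _ _).1 pxy; [exact: S0|exact: S0|right].
  by apply: (prefE _ _ _).1 pxy; [exact: S0|exact: S0|left].
move=> [Sx xmax]; have [[y FSy] _] := F_sol pS; have Sy := F_sub pS FSy.
have [xE|xn0] := eqVneq x 0; last first.
  apply: (pref_F _ eS FSy Sx); apply/prefE; [exact: S0|exact: S0|by left|].
  exact: xmax.
have [yE|yn0] := eqVneq y 0; first by rewrite xE -yE.
apply: (pref_F _ eS FSy Sx); apply/prefE; [exact: S0|exact: S0|by right|].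
exact: xmax.
Qed.

(** Scaling by the inverse maxima yields an equal problem with all maxima 1, where [F] maximizes
    [value]; scale invariance carries this back to [S]. *)
Lemma F_argmax S : problem S -> F S = argmax S (fun x => value (normalize S x)).
Proof.
move=> pS; pose a := (\row_i (best S i)^-1 : 'rV[R]_n).
have a0 : vltall 0 a by move=> i; rewrite !mxE invr_gt0 best_gt0.
have nE x : normalize S x = vmul a x.
  by apply/rowP => i; rewrite !mxE mulrC.
have aI : injective (vmul a).
  move=> x y /rowP xy; apply/rowP => i; have := xy i; rewrite !mxE.
  by apply/mulfI; rewrite invr_neq0 // gt_eqF // best_gt0.
have eS' : equal_problem (vmul a @` S).
  split; first exact: problem_vmul.
  have b1 i : best (vmul a @` S) i = 1.
    by rewrite best_vmul // mxE mulVf // gt_eqF // best_gt0.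
  by move=> i j; rewrite !b1.
have FS' x : F S x <-> F (vmul a @` S) (vmul a x).
  rewrite F_scale //; split=> [?|[y ? /aI <- //]]; by exists x.
apply/seteqP; split=> x.
  move=> /[dup] /(F_sub pS) Sx /FS'; rewrite F_argmax_equal // => -[_ h].
  by split=> // y Sy; rewrite !nE; apply: h; exists y.
move=> [Sx h]; apply/FS'; rewrite F_argmax_equal //; split; first by exists x.
by move=> _ [y Sy <-]; rewrite -!nE; exact: h.
Qed.

End Preference.

(** * From homogeneity over the integers to homogeneity over the nonnegative reals *)

Section Homogeneity.
Variables (R : realType) (n : nat).
Variable g : 'rV[R]_n -> R.
Hypothesis g_mono : forall u v, vle u v -> g u <= g v.
Hypothesis g_shift : forall u c, g (u + const_mx c) = g u + c.
Implicit Types (u v w z : 'rV[R]_n) (i j : 'I_n) (l s c : R).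

Let sumnorm u : R := \sum_i `|u 0 i|.

Lemma le_sumnorm u i : `|u 0 i| <= sumnorm u.
Proof. by rewrite /sumnorm (bigD1 i) //= lerDl sumr_ge0. Qed.

Lemma sumnormZ l u : sumnorm (l *: u) = `|l| * sumnorm u.
Proof.
by rewrite /sumnorm mulr_sumr; apply: eq_bigr => i _; rewrite mxE normrM.
Qed.

Lemma sumnorm_ge0 u : 0 <= sumnorm u.
Proof. by apply: sumr_ge0. Qed.

(** The vector [u] lies below [v] shifted by the constant [sumnorm (u - v)], and symmetrically. *)
Lemma shift_mono_lipschitz u v : `|g u - g v| <= sumnorm (u - v).
Proof.
have h u' v' : g u' <= g v' + sumnorm (u' - v').
  rewrite -g_shift; apply: g_mono => i; rewrite !mxE.
  have := le_sumnorm (u' - v') i; rewrite !mxE ler_norml => /andP[_].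
  by rewrite lerBlDr addrC.
have sC : sumnorm (v - u) = sumnorm (u - v).
  by rewrite -opprB -scaleN1r sumnormZ normrN1 mul1r.
by have := h u v; have := h v u; rewrite sC ler_norml => ? ?;
  apply/andP; split; lra.
Qed.

Hypothesis g_natmul : forall m u, (0 < m)%N -> g (m%:R *: u) = m%:R * g u.

Lemma shift_mono_at0 : g 0 = 0.
Proof. by have := @g_natmul 2 0 isT; rewrite scaler0 => ?; lra. Qed.

(** Multiply the defect by an integer [k] and round [k * l] down to an integer [m]. By the Lipschitz
    bound the rounding costs at most [C], which is independent of [k], so the defect vanishes by the
    Archimedean property. *)
Lemma homogeneous_of_natmul l u : 0 <= l -> g (l *: u) = l * g u.
Proof.
move=> l0; pose C := sumnorm u + `|g u|.
have bound k : (0 < k)%N -> k%:R * `|g (l *: u) - l * g u| <= C.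
  move=> k0; pose m := Num.trunc (k%:R * l).
  have /andP[ml lm] : m%:R <= k%:R * l < m.+1%:R by rewrite truncn_itv ?mulr_ge0.
  have d1 : `|k%:R * l - m%:R| <= 1.
    by rewrite ger0_norm ?subr_ge0 // lerBlDr // addrC natr1 ltW.
  have gm : g (m%:R *: u) = m%:R * g u.
    by case: (posnP m) => [->|/g_natmul //]; rewrite scale0r mul0r shift_mono_at0.
  rewrite -{1}[k%:R]ger0_norm // -normrM mulrBr -g_natmul // scalerA mulrA.
  have -> : g ((k%:R * l) *: u) - k%:R * l * g u =
    (g ((k%:R * l) *: u) - g (m%:R *: u)) - (k%:R * l - m%:R) * g u.
    by rewrite gm; ring.
  apply: le_trans (ler_normB _ _) _; rewrite normrM lerD //.
    apply: le_trans (shift_mono_lipschitz _ _) _.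
    by rewrite -scalerBl sumnormZ ler_piMl ?sumnorm_ge0.
  by rewrite ler_piMl.
apply/eqP; rewrite -subr_eq0 -normr_eq0 eq_le normr_ge0 andbT leNgt.
apply/negP => d0; have := bound (Num.bound (C / `|g (l *: u) - l * g u|)).+1 isT.
apply/negP; rewrite -ltNge -ltr_pdivrMr //.
have C0 : 0 <= C by rewrite addr_ge0 ?sumnorm_ge0.
apply: lt_le_trans (archi_boundP _) _; first by rewrite divr_ge0 // ltW.
by rewrite ler_nat.
Qed.

End Homogeneity.

(** * Convex hulls of finitely many weights, parametrized by stochastic matrices *)

Section Hulls.
Variables (R : realType) (n K : nat).
Implicit Types (M : 'M[R]_(K, n)) (u w : 'rV[R]_n) (c : 'rV[R]_K).

Definition dot w u : R := \sum_i w 0 i * u 0 i.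

Lemma mx_functional_continuous (k : 'I_K) u :
  continuous (fun M : 'M[R]_(K, n) => dot (row k M) u).
Proof.
rewrite (_ : (fun M => _) = (fun M => \sum_i M k i * u 0 i)); last first.
  by apply/funext => M; apply: eq_bigr => i _; rewrite mxE.
apply: (continuous_big add_continuous) => i _ M.
by apply: continuousM; [exact: coord_continuous|exact: cst_continuous].
Qed.

(** The box of matrices is the image of a compact box of row vectors under [vec_mx], which preserves
    entrywise distances. *)
Lemma compact_unit_mx :
  compact [set M : 'M[R]_(K, n) | forall k i, 0 <= M k i <= 1].
Proof.
pose A := [set v : 'rV[R]_(K * n) | forall i, `[0, 1]%classic (v ord0 i)].
have cA : compact A.
  apply: (@rV_compact R _ (fun=> `[0, 1]%classic)) => _.
  exact: segment_compact.
have -> : [set M : 'M[R]_(K, n) | forall k i, 0 <= M k i <= 1] =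
    (fun v => vec_mx v) @` A.
  apply/seteqP; split=> [M M01|_ [v v01 <-] k i]; last first.
    by have := v01 (mxvec_index k i); rewrite !mxE /= in_itv.
  exists (mxvec M); last exact: mxvecK.
  by move=> i; case/mxvec_indexP: i => k i; rewrite mxvecE /= in_itv; exact: M01.
apply: continuous_compact => //; apply: continuous_subspaceT => v.
suff cv (x : 'rV[R]_(K * n)) : vec_mx y @[y --> x] --> (vec_mx x : 'M[R]_(K, n)).
  exact: cv.
apply: (iffRL (@cvg_ballP R _ _ (nbhs x) _ _ _)) => e e0.
apply/nbhs_ballP; exists e => //= y [_ xy].
by split=> // k i; rewrite !mxE; exact: xy.
Qed.

(** The convex hull of the rows of [M]. *)
Definition mx_hull M : set 'rV[R]_n := [set c *m M | c in @weights R K].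

Lemma mulmx_coord c M i : (c *m M) 0 i = \sum_k c 0 k * M k i.
Proof. by rewrite mxE. Qed.

Lemma dot_mulmx c M u : dot (c *m M) u = \sum_k c 0 k * dot (row k M) u.
Proof.
rewrite /dot; under eq_bigr do rewrite mulmx_coord mulr_suml.
rewrite exchange_big /=; apply: eq_bigr => k _; rewrite mulr_sumr.
by apply: eq_bigr => i _; rewrite mxE mulrA.
Qed.

Lemma weights_delta (k : 'I_K) : weights (delta_mx 0 k : 'rV[R]_K).
Proof.
split; first by apply: orthantP => i; rewrite mxE ler0n.
rewrite (bigD1 k) //= mxE !eqxx big1 ?addr0 // => i ik.
by rewrite mxE eqxx (negbTE ik).
Qed.

Lemma mx_hull_row M k : mx_hull M (row k M).
Proof. by exists (delta_mx 0 k); [exact: weights_delta|rewrite rowE]. Qed.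

Lemma weights_le1 m (w : 'rV[R]_m) i : weights w -> 0 <= w 0 i <= 1.
Proof.
move=> [w0 <-]; rewrite orthant_ge0 // (bigD1 i) //= lerDl sumr_ge0 // => j _.
exact: orthant_ge0.
Qed.

Lemma weights_mulmx c M : weights c -> (forall k, weights (row k M)) ->
  weights (c *m M).
Proof.
move=> [c0 c1] wM; split.
  apply: orthantP => i; rewrite mulmx_coord sumr_ge0 // => k _.
  have := orthant_ge0 i (wM k).1; rewrite mxE => ?.
  by rewrite mulr_ge0 ?orthant_ge0.
under eq_bigr do rewrite mulmx_coord.
rewrite exchange_big /= -c1; apply: eq_bigr => k _; rewrite -mulr_sumr.
have [_] := wM k; under eq_bigr do rewrite mxE.
by move=> ->; rewrite mulr1.
Qed.

(** Points with the same coefficients [c] are paired; their distance is at most an average of the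
    entrywise distances. Radius [e / 2] leaves room for the strict inequality in the conclusion. *)
Lemma hausdorff_mx_hull M M' e : 0 < e -> ball M (e / 2) M' ->
  hausdorff_ball (mx_hull M : hyperspace 'rV[R]_n) e (mx_hull M').
Proof.
move=> e0 MM'; have h c : weights c -> ball (c *m M) e (c *m M').
  move=> [c0 c1]; apply/rV_ballP; split=> // i.
  rewrite !mulmx_coord -sumrB; apply: le_lt_trans (ler_norm_sum _ _ _) _.
  apply: (@le_lt_trans _ _ (\sum_k c 0 k * (e / 2))).
    apply: ler_sum => k _; rewrite -mulrBr normrM ger0_norm ?orthant_ge0 //.
    rewrite ler_wpM2l ?orthant_ge0 //; case: MM' => _ /(_ k i).
    by move=> /ltW.
  by rewrite -mulr_suml c1 mul1r; lra.
split=> _ [c wc <-]; [exists (c *m M')|exists (c *m M)].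
- by exists c.
- exact: h.
- by exists c.
- exact/ball_sym/h.
Qed.

Lemma mx_hull_continuous :
  continuous (fun M : 'M[R]_(K, n) => mx_hull M : hyperspace 'rV[R]_n).
Proof.
suff cv (M : 'M[R]_(K, n)) : (mx_hull N : hyperspace _) @[N --> M] -->
    (mx_hull M : hyperspace 'rV[R]_n) by exact: cv.
apply: (iffRL (@cvg_ballP R _ _ (nbhs M) _ _ _)) => e e0.
apply/nbhs_ballP; exists (e / 2); first by rewrite /= divr_gt0.
by move=> N MN; exact: hausdorff_mx_hull.
Qed.

Lemma dot_delta (i : 'I_n) u : dot (delta_mx 0 i) u = u 0 i.
Proof.
rewrite /dot (bigD1 i) //= mxE !eqxx mul1r big1 ?addr0 // => j ji.
by rewrite mxE eqxx (negbTE ji) mul0r.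
Qed.

Lemma dot1 w : dot w (const_mx 1) = \sum_i w 0 i.
Proof. by apply: eq_bigr => j _; rewrite mxE mulr1. Qed.

Lemma dotC w u : dot w u = dot u w.
Proof. by apply: eq_bigr => i _; rewrite mulrC. Qed.

Lemma closed_row_functional k u (A : set R) :
  closed A -> closed [set M : 'M[R]_(K, n) | A (dot (row k M) u)].
Proof.
exact: (iffLR (continuous_closedP _) (@mx_functional_continuous k u) A).
Qed.

Lemma closed_stochastic :
  closed [set M : 'M[R]_(K, n) | forall k, weights (row k M)].
Proof.
have -> : [set M : 'M[R]_(K, n) | forall k, weights (row k M)] =
    (\bigcap_(k in setT) \bigcap_(i in setT)
       [set M | [set t | 0 <= t] (dot (row k M) (delta_mx 0 i))]) `&`
    (\bigcap_(k in setT)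
       [set M | [set t | t = 1] (dot (row k M) (const_mx 1))]).
  apply/seteqP; split=> [M wM|M [M0 M1] k].
    split=> [k _ i _|k _] /=; last by rewrite dot1; exact: (wM k).2.
    by rewrite dotC dot_delta; exact: orthant_ge0 (wM k).1.
  split; last by rewrite -dot1; exact: M1.
  by apply: orthantP => i; rewrite -dot_delta dotC; exact: M0.
apply: closedI.
  apply: closed_bigI => k _; apply: closed_bigI => i _.
  apply: closed_row_functional; exact: closed_ge.
by apply: closed_bigI => k _; apply: closed_row_functional; exact: closed_eq.
Qed.

Lemma compact_stochastic :
  compact [set M : 'M[R]_(K, n) | forall k, weights (row k M)].
Proof.
apply: subclosed_compact closed_stochastic compact_unit_mx _.
by move=> M wM k i; have := weights_le1 i (wM k); rewrite mxE.
Qed.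

End Hulls.

Lemma compact_weights (R : realType) (K : nat) : compact (@weights R K).
Proof.
rewrite (_ : @weights R K = [set M : 'M[R]_(1, K) | forall k, weights (row k M)]).
  exact: compact_stochastic.
by apply/seteqP; split=> [c wc k|c /(_ 0)]; rewrite row_id.
Qed.

Lemma dot_continuous (R : realType) (n : nat) (u : 'rV[R]_n) :
  continuous (fun w => dot w u).
Proof.
have := @mx_functional_continuous R n 1 0 u.
by rewrite (_ : (fun w => _) = (fun w => dot w u)) //; apply/funext => w;
  rewrite row_id.
Qed.

Lemma compact_mx_hull (R : realType) (n K : nat) (M : 'M[R]_(K, n)) :
  compact (mx_hull M).
Proof.
apply: continuous_compact; last exact: compact_weights.
apply: continuous_subspaceT; apply: rV_continuous => i.
have := @dot_continuous R K (col i M)^T.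
rewrite (_ : (fun c => _) = (fun c : 'rV[R]_K => (c *m M) 0 i)) //.
apply/funext => c; rewrite mulmx_coord.
by apply: eq_bigr => k _; rewrite !mxE.
Qed.

Lemma convex_mx_hull (R : realType) (n K : nat) (M : 'M[R]_(K, n)) :
  convex_set (mx_hull M).
Proof.
move=> x y l; rewrite !inE => -[c [c0 c1] <-] [d [d0 d1] <-].
have l0 : 0 <= l%:num by [].
have l1 : 0 <= 1 - l%:num by rewrite subr_ge0.
exists (l%:num *: c + (1 - l%:num) *: d).
  split.
    apply: orthantP => k.
    by rewrite !mxE addr_ge0 // mulr_ge0 ?(orthant_ge0 k c0) ?(orthant_ge0 k d0).
  under eq_bigr do rewrite !mxE.
  by rewrite big_split /= -!mulr_sumr c1 d1 !mulr1 subrKC.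
by rewrite mulmxDl -!scalemxAl.
Qed.

(** * Max-min representation of monotone, translation equivariant, positively homogeneous
    functions *)

Section Representation.
Variables (R : realType) (n : nat) (i0 : 'I_n).
Variable g : 'rV[R]_n -> R.
Hypothesis g_mono : forall u v, vle u v -> g u <= g v.
Hypothesis g_shift : forall u c, g (u + const_mx c) = g u + c.
Hypothesis g_scale : forall l u, 0 <= l -> g (l *: u) = l * g u.
Hypothesis g_perm : forall u (p : 'S_n), g (col_perm p u) = g u.
Implicit Types (u v w z : 'rV[R]_n) (i j : 'I_n) (l s c : R).

(** One row for each ordered pair of coordinates, the index set of [edge_point]. *)
Let K := #|{: 'I_n * 'I_n}|.
Implicit Types (M : 'M[R]_(K, n)) (k : 'I_K).

(** These are the stochastic matrices whose hull has minimum of [dot w u] at most [g u] for every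
    [u], since a linear function attains its minimum over a hull at a row. Stated with rows, the
    condition at each [u] is a finite union of closed ones. *)
Definition minorants : set 'M[R]_(K, n) :=
  [set M | (forall k, weights (row k M)) /\
           forall u, exists k, dot (row k M) u <= g u].

Lemma dot_const w c : weights w -> dot w (const_mx c) = c.
Proof.
move=> [_ w1]; rewrite /dot; under eq_bigr do rewrite mxE.
by rewrite -mulr_suml w1 mul1r.
Qed.

Lemma dotDl w w' u : dot (w + w') u = dot w u + dot w' u.
Proof. by rewrite -big_split; apply: eq_bigr => i _; rewrite mxE mulrDl. Qed.

Lemma dotZl c w u : dot (c *: w) u = c * dot w u.
Proof. by rewrite /dot mulr_sumr; apply: eq_bigr => i _; rewrite mxE mulrA. Qed.

Lemma dotDr w u v : dot w (u + v) = dot w u + dot w v.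
Proof. by rewrite -big_split; apply: eq_bigr => i _; rewrite mxE mulrDr. Qed.

Lemma dot_perm w u (p : 'S_n) : dot (col_perm p w) u = dot w (col_perm p^-1 u).
Proof.
rewrite /dot (reindex_inj (@perm_inj _ p^-1)) /=.
by apply: eq_bigr => i _; rewrite !mxE permKV.
Qed.

Lemma weights_perm w (p : 'S_n) : weights w -> weights (col_perm p w).
Proof.
move=> [w0 w1]; split; first exact: orthant_perm.
rewrite -w1 [RHS](reindex_inj (@perm_inj _ p)) /=.
by apply: eq_bigr => i _; rewrite mxE.
Qed.

Lemma compact_minorants : compact minorants.
Proof.
have -> : minorants = [set M | forall k, weights (row k M)] `&`
    \bigcap_(u in setT) \bigcup_(k in setT)
      [set M | [set t | t <= g u] (dot (row k M) u)].
  apply/seteqP; split=> [M [wM gM]|M [wM gM]]; split=> // u.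
    by move=> _; have [k ?] := gM u; exists k.
  by have [k _ ?] := gM u I; exists k.
apply: compact_closedI; first exact: compact_stochastic.
apply: closed_bigI => u _; apply: closed_bigcup; first exact: finite_finset.
by move=> k _; apply: closed_row_functional; exact: closed_le.
Qed.

(* The vertices of the part of the simplex where [dot w z >= 0]: they lie on its
   edges. *)
Definition edge_point z i j : 'rV[R]_n :=
  if (0 < z 0 i) && (z 0 j < 0) then
    (z 0 i - z 0 j)^-1 *: (- z 0 j *: delta_mx 0 i + z 0 i *: delta_mx 0 j)
  else if 0 <= z 0 i then delta_mx 0 i
  else delta_mx 0 [arg max_(m > i0) z 0 m]%O.

Lemma edge_point_dot z i j u : 0 < z 0 i -> z 0 j < 0 ->
  dot (edge_point z i j) u =
  (z 0 i - z 0 j)^-1 * (- z 0 j * u 0 i + z 0 i * u 0 j).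
Proof.
by move=> zi zj; rewrite /edge_point zi zj /= dotZl dotDl !dotZl !dot_delta.
Qed.

Lemma weights_edge_point z i j : weights (edge_point z i j).
Proof.
have [/andP[zi zj]|zij] := boolP ((0 < z 0 i) && (z 0 j < 0)); last first.
  rewrite /edge_point (negbTE zij) /=.
  by case: ifP => _; exact: weights_delta.
have d0 : 0 < z 0 i - z 0 j by rewrite subr_gt0 (lt_trans zj).
split; last first.
  by rewrite -dot1 edge_point_dot // !mxE !mulr1 [- _ + _]addrC mulVf // gt_eqF.
apply: orthantP => m; rewrite -dot_delta dotC edge_point_dot // mulr_ge0 //.
  by rewrite invr_ge0 ltW.
by rewrite !mxE addr_ge0 // mulr_ge0 ?ler0n ?oppr_ge0 // ltW.
Qed.

Lemma edge_point_ge0 z i j : g z = 0 -> 0 <= dot (edge_point z i j) z.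
Proof.
move=> gz; have [/andP[zi zj]|zij] := boolP ((0 < z 0 i) && (z 0 j < 0)).
  by rewrite edge_point_dot // mulNr [z 0 j * _]mulrC addNr mulr0.
rewrite /edge_point (negbTE zij) /=; case: ifP => [zi|_]; rewrite dot_delta //.
(* The vector [z] lies below the constant vector at its largest coordinate, so that coordinate is at
   least [g z], which is 0. *)
case: arg_maxP => //= m _ mmax; rewrite -gz.
have := @g_mono z (0 *: z + const_mx (z 0 m)).
rewrite g_shift g_scale // mul0r add0r; apply => m'.
by rewrite !mxE mul0r add0r; exact: mmax.
Qed.

(* The dual multiplier [l] exists by Helly's theorem on the line: its
   constraints, one per coordinate, are pairwise compatible. *)
Lemma edge_point_minorant z u s : g z = 0 ->
  (forall i j, s <= dot (edge_point z i j) u) -> s <= g u.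
Proof.
move=> gz h.
have vert i : 0 <= z 0 i -> s <= u 0 i.
  move=> zi; have := h i i; rewrite /edge_point zi.
  by case: (ltP (z 0 i) 0) => [|_]; rewrite ?andbF ?dot_delta // ltNge zi.
pose l := \big[Num.max/0]_(j | z 0 j < 0) ((s - u 0 j) / - z 0 j).
have l0 : 0 <= l by apply: bigmax_ge_id.
have le_u i : l * z 0 i + s <= u 0 i.
  case: (ltgtP (z 0 i) 0) => zi.
  - have : (s - u 0 i) / - z 0 i <= l.
      exact: (le_bigmax_cond _ (fun j => (s - u 0 j) / - z 0 j)).
    by rewrite ler_pdivrMr ?oppr_gt0 //; lra.
  (* Pairwise compatibility: the lower bound on [l] from [j] lies below the upper bound from [i],
     which is [hij] after clearing denominators. *)
  - suff : l <= (u 0 i - s) / z 0 i by rewrite ler_pdivlMr //; lra.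
    apply/bigmax_leP; split=> [|j zj].
      by rewrite divr_ge0 ?subr_ge0 ?vert // ltW.
    have d0 : 0 < z 0 i - z 0 j by lra.
    have := h i j; rewrite edge_point_dot // mulrC ler_pdivlMr // => hij.
    by rewrite ler_pdivrMr ?oppr_gt0 // mulrAC ler_pdivlMr //; nra.
  - by rewrite zi mulr0 add0r vert ?zi.
(* The vector [u] dominates [l *: z + const_mx s], at which [g] equals [s] because [g z = 0]. *)
have := @g_mono (l *: z + const_mx s) u.
by rewrite g_shift g_scale // gz mulr0 add0r; apply => i; rewrite !mxE.
Qed.

Definition edge_mx z : 'M[R]_(K, n) :=
  \matrix_(k, i) edge_point z (enum_val k).1 (enum_val k).2 0 i.

Lemma row_edge_mx z k :
  row k (edge_mx z) = edge_point z (enum_val k).1 (enum_val k).2.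
Proof. by apply/rowP => i; rewrite !mxE. Qed.

(** The smallest [dot] of [u] with a row can be taken as [s] in [edge_point_minorant]. *)
Lemma edge_mx_minorant z : g z = 0 -> minorants (edge_mx z).
Proof.
move=> gz; split=> [k|u]; first by rewrite row_edge_mx; exact: weights_edge_point.
have k0 : 'I_K := enum_rank (i0, i0).
have [k _ kmin] := @arg_minP _ _ _ k0 xpredT
  (fun k => dot (row k (edge_mx z)) u) isT.
exists k; apply: (edge_point_minorant gz) => i j.
have := kmin (enum_rank (i, j)) isT.
by rewrite (row_edge_mx z (enum_rank (i, j))) enum_rankK.
Qed.

Definition collection : set (hyperspace 'rV[R]_n) :=
  [set mx_hull M | M in minorants].

Lemma collection_neq0 : collection !=set0.
Proof.
have g0 : g 0 = 0 by rewrite -(scale0r 0) g_scale // mul0r.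
by exists (mx_hull (edge_mx 0)); exists (edge_mx 0); first exact: edge_mx_minorant.
Qed.

Lemma compact_collection : compact collection.
Proof.
apply: continuous_compact; last exact: compact_minorants.
by apply: continuous_subspaceT; exact: mx_hull_continuous.
Qed.

Lemma col_perm_mulmx (p : 'S_n) (c : 'rV[R]_K) M :
  col_perm p (c *m M) = c *m col_perm p M.
Proof.
by apply/rowP => i; rewrite !mxE; apply: eq_bigr => k _; rewrite mxE.
Qed.

Lemma symmetric_collection_hulls : symmetric_collection collection.
Proof.
move=> _ [M [wM gM] <-] p; exists (col_perm p M); last first.
  apply/seteqP; split=> [_ [c wc <-]|_ [_ [c wc <-] <-]].
    by exists (c *m M); [exists c|rewrite col_perm_mulmx].
  by exists c => //; rewrite col_perm_mulmx.
have rE k : row k (col_perm p M) = col_perm p (row k M).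
  by apply/rowP => i; rewrite !mxE.
split=> [k|u]; first by rewrite rE; exact: weights_perm.
have [k ku] := gM (col_perm p^-1 u).
by exists k; rewrite rE dot_perm -(g_perm u p^-1).
Qed.

Lemma collection_convex W : collection W ->
  [/\ W !=set0, closed (W : set 'rV[R]_n), convex_set (W : set 'rV[R]_n)
    & W `<=` @weights R n].
Proof.
move=> [M [wM gM] <-]; split.
- have k0 : 'I_K := enum_rank (i0, i0).
  by exists (row k0 M); exact: mx_hull_row.
- by apply: compact_closed; [exact: norm_hausdorff|exact: compact_mx_hull].
- exact: convex_mx_hull.
- by move=> _ [c wc <-]; exact: weights_mulmx.
Qed.

Lemma wgeomean_exp w y : pos_orthant y ->
  wgeomean w y = expR (dot w (map_mx (@ln R) y)).
Proof.
move=> y0; rewrite expR_sum; apply: eq_bigr => i _; rewrite mxE mulrC expRM.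
by rewrite lnK // posrE; have := y0 i; rewrite mxE.
Qed.

Lemma maxmin_collection y : pos_orthant y ->
  is_max [set t | exists2 W, collection W & is_min [set wgeomean w y | w in W] t]
    (expR (g (map_mx (@ln R) y))).
Proof.
move=> y0; set u := map_mx _ y; have wE w := wgeomean_exp w y0.
have max_row W (t : R) : collection W -> is_min [set wgeomean w y | w in W] t ->
    t <= expR (g u).
  move=> [M [wM gM] <-] [_ vmin]; have [k ku] := gM u.
  apply: (@le_trans _ _ (wgeomean (row k M) y)).
    by apply: vmin; exists (row k M) => //; exact: mx_hull_row.
  by rewrite wE ler_expR.
split; last by move=> t [W WW vmin]; exact: max_row vmin.
(* The shift makes [g z = 0]. Every weight in the hull of [edge_mx z] has nonnegative [dot] with
   [z], that is, at least [g u] with [u]; the minorant property supplies a row attaining [g u]. *)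
pose z := u + const_mx (- g u).
have gz : g z = 0 by rewrite g_shift subrr.
have [wM gM] := edge_mx_minorant gz.
exists (mx_hull (edge_mx z)); first by exists (edge_mx z).
have ge w : mx_hull (edge_mx z) w -> g u <= dot w u.
  move=> [c wc <-]; have wcM := weights_mulmx wc wM.
  suff : 0 <= dot (c *m edge_mx z) z.
    by rewrite dotDr dot_const // subr_ge0.
  rewrite dot_mulmx sumr_ge0 // => k _.
  by rewrite mulr_ge0 ?(orthant_ge0 k wc.1) // row_edge_mx edge_point_ge0.
have [k ku] := gM u; have rk := mx_hull_row (edge_mx z) k.
split; last by move=> _ [w /ge wu <-]; rewrite wE ler_expR.
exists (row k (edge_mx z)) => //; rewrite wE; congr expR.
by apply: le_anti; rewrite ku ge.
Qed.

End Representation.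

(** * Passage to logarithmic coordinates *)

Section LogCoordinates.
Variables (R : realType) (n : nat).
Variable V : 'rV[R]_n -> R.
Hypothesis V_mono : forall x y, orthant x -> orthant y -> vle x y -> V x <= V y.
Hypothesis V_scale : forall (l : R) x, 0 < l -> orthant x ->
  V (vmul (const_mx l) x) = l * V x.
Hypothesis V_vpow : forall m x, (0 < m)%N -> orthant x -> V (vpow m x) = V x ^+ m.
Hypothesis V_const : forall t : R, 0 <= t -> V (const_mx t) = t.
Hypothesis V_perm : forall x (p : 'S_n), orthant x -> V (col_perm p x) = V x.

Let expv (u : 'rV[R]_n) := map_mx (@expR R) u.

Let expv_orthant u : orthant (expv u).
Proof. by apply: orthantP => i; rewrite mxE expR_ge0. Qed.

Definition log_value (u : 'rV[R]_n) : R := ln (V (expv u)).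

Lemma pos_value_gt0 x : pos_orthant x -> 0 < V x.
Proof.
move=> x0; pose c := \big[Num.min/1]_i x 0 i.
have c0 : 0 < c.
  by apply/bigmin_gtP; split=> // i _; have := x0 i; rewrite mxE.
rewrite (lt_le_trans c0) // -{1}(V_const (ltW c0)); apply: V_mono.
- exact/orthant_const/ltW.
- exact: orthant_pos.
- by move=> i; rewrite mxE; exact: bigmin_le.
Qed.

Let Vexp_gt0 u : 0 < V (expv u).
Proof. by apply: pos_value_gt0 => i; rewrite !mxE expR_gt0. Qed.

Lemma log_value_mono u v : vle u v -> log_value u <= log_value v.
Proof.
move=> uv; rewrite /log_value ler_ln ?posrE //; apply: V_mono => // i.
by rewrite !mxE ler_expR.
Qed.

Lemma log_value_shift u (c : R) : log_value (u + const_mx c) = log_value u + c.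
Proof.
rewrite /log_value (_ : expv _ = vmul (const_mx (expR c)) (expv u)).
  by rewrite V_scale ?expR_gt0 // lnM ?posrE ?expR_gt0 // expRK addrC.
by apply/rowP => i; rewrite !mxE addrC expRD.
Qed.

Lemma log_value_natmul m u : (0 < m)%N ->
  log_value (m%:R *: u) = m%:R * log_value u.
Proof.
move=> m0; rewrite /log_value (_ : expv _ = vpow m (expv u)).
  by rewrite V_vpow // lnXn // mulr_natl.
by apply/rowP => i; rewrite !mxE expRM_natl.
Qed.

Lemma log_value_perm u (p : 'S_n) : log_value (col_perm p u) = log_value u.
Proof.
rewrite /log_value (_ : expv _ = col_perm p (expv u)) ?V_perm //.
by apply/rowP => i; rewrite !mxE.
Qed.

Lemma exp_log_value x : pos_orthant x ->
  expR (log_value (map_mx (@ln R) x)) = V x.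
Proof.
move=> x0; rewrite /log_value lnK ?posrE //; congr V.
by apply/rowP => i; rewrite !mxE lnK // posrE; have := x0 i; rewrite mxE.
Qed.

End LogCoordinates.

(** * Properties of the max-min of weighted geometric means, first on the positive orthant, then on
    its closure *)

Section MaxMin.
Variables (R : realType) (n : nat).
Variables (WW : set (hyperspace 'rV[R]_n)) (V : 'rV[R]_n -> R).
Hypothesis WW_sym : symmetric_collection WW.
Hypothesis WW_sub : forall W : set 'rV[R]_n, WW W ->
  [/\ W !=set0, closed W, convex_set W & W `<=` @weights R n].
Hypothesis WV : maxmin_geomean WW V.
Implicit Types (w x y z : 'rV[R]_n) (W : set 'rV[R]_n) (l t : R).

(** [maxmin_geomean] supplies an attained minimum only for an optimal member of the collection; for
    any member, compactness of the simplex supplies one. *)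
Lemma wgeomean_min_ex W y : WW W -> pos_orthant y ->
  exists v, is_min [set wgeomean w y | w in W] v.
Proof.
move=> /WW_sub[W0 cW _ Ww] y0.
have W_compact : compact W by apply: subclosed_compact cW (@compact_weights R n) _.
have cf : {within W, continuous (fun w => wgeomean w y)}.
  rewrite (_ : (fun w => _) = (fun w => expR (dot w (map_mx (@ln R) y)))).
    apply: continuous_subspaceT => w.
    by apply: continuous_comp; [exact: dot_continuous|exact: continuous_expR].
  by apply/funext => w; rewrite wgeomean_exp.
have [w Ww' wmin] := compact_EVT_min W0 W_compact cf.
exists (wgeomean w y); split; first by exists w => //; exact: set_mem.
by move=> _ [w' /mem_set/wmin ? <-].
Qed.

(** Take [W] optimal at [y], its companion [W'], a minimizer [w'] of [W'] at [y'] and the matching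
    [w]: then [phi (V y)] is at most [phi (wgeomean w y)], hence at most the minimum over [W'],
    hence at most [V y']. *)
Lemma maxmin_transfer (phi : R -> R) y y' : pos_orthant y -> pos_orthant y' ->
  (forall s t, 0 <= s -> s <= t -> phi s <= phi t) ->
  (forall W, WW W -> exists2 W', WW W' & forall w', W' w' ->
     exists2 w, W w & phi (wgeomean w y) <= wgeomean w' y') ->
  phi (V y) <= V y'.
Proof.
move=> y0 y'0 phi_mono h; have [V_max _] := WV.
have [[W WWW [[w1 Ww1 <-] wmin]] _] := V_max y y0.
have [W' WWW' W'W] := h W WWW.
have [v' v'min] := wgeomean_min_ex WWW' y'0.
have [_ /(_ v')] := V_max y' y'0; move=> /(_ (ex_intro2 _ _ W' WWW' v'min)).
apply: le_trans; have [[w' /W'W[w Ww wle] <-] _] := v'min.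
apply: le_trans wle; apply: phi_mono; last by apply: wmin; exists w.
by apply: prodr_ge0 => i _; exact: powR_ge0.
Qed.

Lemma maxmin_pos_gt0 y : pos_orthant y -> 0 < V y.
Proof.
move=> y0; have [V_max _] := WV; have [[W _ [[w _ <-] _]] _] := V_max y y0.
by rewrite wgeomean_exp // expR_gt0.
Qed.

Lemma pos_orthantP x : pos_orthant x <-> forall i, 0 < x 0 i.
Proof. by split=> h i; have := h i; rewrite mxE. Qed.

Lemma maxmin_pos_mono y y' : pos_orthant y -> pos_orthant y' -> vle y y' ->
  V y <= V y'.
Proof.
move=> y0 y'0 yy'; apply: (@maxmin_transfer id) => // W WWW; exists W => // w Ww.
exists w => //; rewrite !wgeomean_exp // ler_expR; apply: ler_sum => i _.
have [_ _ _ /(_ w Ww)[w0 _]] := WW_sub WWW.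
rewrite ler_wpM2l ?(orthant_ge0 i w0) // !mxE ler_ln ?posrE //.
  by move/pos_orthantP: y0.
by move/pos_orthantP: y'0.
Qed.

Lemma maxmin_pos_perm y (p : 'S_n) : pos_orthant y -> V (col_perm p y) = V y.
Proof.
have le (q : 'S_n) x : pos_orthant x -> V x <= V (col_perm q x).
  move=> x0; have qx0 : pos_orthant (col_perm q x).
    by apply/pos_orthantP => i; rewrite mxE; move/pos_orthantP: x0.
  apply: (@maxmin_transfer id) => // W WWW.
  exists (col_perm q @` W); first exact: WW_sym.
  move=> _ [w Ww <-]; exists w => //; rewrite !wgeomean_exp // dot_perm.
  rewrite (_ : col_perm _ (map_mx _ _) = map_mx (@ln R) x) //.
  by apply/rowP => i; rewrite !mxE permKV.
move=> y0; apply: le_anti; rewrite le // andbT.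
rewrite -{2}(col_permK p y) le //.
by apply/pos_orthantP => i; rewrite mxE; move/pos_orthantP: y0.
Qed.

Lemma vmul_const_pos l y : 0 < l -> pos_orthant y ->
  pos_orthant (vmul (const_mx l) y).
Proof.
move=> l0 /pos_orthantP y0; apply/pos_orthantP => i.
by rewrite !mxE mulr_gt0.
Qed.

Lemma wgeomean_scale w l y : weights w -> 0 < l -> pos_orthant y ->
  wgeomean w (vmul (const_mx l) y) = l * wgeomean w y.
Proof.
move=> ww l0 y0; have ly0 := vmul_const_pos l0 y0.
rewrite !wgeomean_exp // (_ : map_mx _ _ = const_mx (ln l) + map_mx (@ln R) y).
  by rewrite dotDr dot_const // expRD lnK ?posrE.
apply/rowP => i; rewrite !mxE lnM // posrE; exact: (pos_orthantP y).1.
Qed.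

Lemma maxmin_pos_scale l y : 0 < l -> pos_orthant y ->
  V (vmul (const_mx l) y) = l * V y.
Proof.
have le l' x : 0 < l' -> pos_orthant x -> l' * V x <= V (vmul (const_mx l') x).
  move=> l0 x0; apply: (@maxmin_transfer ( *%R l')) => //.
  - exact: vmul_const_pos.
  - by move=> s t _ st; rewrite ler_pM2l.
  - move=> W WWW; exists W => // w Ww; exists w => //; rewrite wgeomean_scale //.
    by have [_ _ _ /(_ w Ww)] := WW_sub WWW.
move=> l0 y0; apply: le_anti; rewrite le // andbT -ler_pdivrMl //.
have li0 : 0 < l^-1 by rewrite invr_gt0.
apply: le_trans (le _ _ li0 (vmul_const_pos l0 y0)) _.
rewrite (_ : vmul _ _ = y) //; apply/rowP => i; rewrite !mxE mulKf //.
by rewrite gt_eqF.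
Qed.

Lemma vpow_pos m y : pos_orthant y -> pos_orthant (vpow m y).
Proof.
by move=> /pos_orthantP y0; apply/pos_orthantP => i; rewrite mxE exprn_gt0.
Qed.

Lemma wgeomean_vpow w m y : pos_orthant y ->
  wgeomean w (vpow m y) = wgeomean w y ^+ m.
Proof.
move=> y0; rewrite !wgeomean_exp ?vpow_pos //; last exact: vpow_pos.
rewrite -expRM_natl; congr expR; rewrite /dot mulr_sumr.
apply: eq_bigr => i _; rewrite !mxE lnXn ?mulrnAr ?mulr_natl //.
exact: (pos_orthantP y).1.
Qed.

Lemma maxmin_pos_vpow m y : (0 < m)%N -> pos_orthant y -> V (vpow m y) = V y ^+ m.
Proof.
move=> m0 y0; have my0 := vpow_pos m y0; have mn0 : m%:R != 0 :> R.
  by rewrite pnatr_eq0 -lt0n.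
have Vy0 := maxmin_pos_gt0 y0; have Vmy0 := maxmin_pos_gt0 my0.
apply: le_anti; apply/andP; split; last first.
  apply: (@maxmin_transfer (fun t => t ^+ m)) => //.
    by move=> s t s0 st; rewrite lerXn2r // nnegrE (le_trans s0).
  by move=> W WWW; exists W => // w Ww; exists w; rewrite ?wgeomean_vpow.
(* The reverse inequality transfers along the m-th root, the inverse of the power. *)
have : V (vpow m y) `^ m%:R^-1 <= V y.
  apply: (@maxmin_transfer (fun t => t `^ m%:R^-1)) => //.
    move=> s t s0 st; apply: ge0_ler_powR; rewrite ?nnegrE ?invr_ge0 //.
    exact: le_trans st.
  move=> W WWW; exists W => // w Ww; exists w => //.
  rewrite wgeomean_vpow // wgeomean_exp // -powR_mulrn ?expR_ge0 //.
  by rewrite -powRrM mulfV // powRr1 // expR_ge0.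
rewrite -(@ler_pXn2r _ m) ?nnegrE ?powR_ge0 ?(ltW Vy0) //.
by rewrite -[_ `^ _ ^+ m]powR_mulrn ?powR_ge0 // -powRrM mulVf // powRr1 // ltW.
Qed.

(** Positive vectors approximating [x], along which relations on the positive orthant pass to its
    boundary. *)
Definition push x (k : nat) : 'rV[R]_n := x + const_mx k.+1%:R^-1.

Lemma push_pos x k : orthant x -> pos_orthant (push x k).
Proof.
by move=> x0; apply/pos_orthantP => i; rewrite !mxE ltr_wpDl ?orthant_ge0.
Qed.

Lemma push_cvg x : push x @ \oo --> x.
Proof.
apply: cvg_rV => i.
rewrite (_ : (fun k => _) = (fun k => x 0 i + k.+1%:R^-1)); last first.
  by apply/funext => k; rewrite !mxE.
rewrite -[X in _ --> X]addr0; apply: cvgD; first exact: cvg_cst.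
exact: cvg_harmonic.
Qed.

Lemma maxmin_cvg (u : nat -> 'rV[R]_n) x : (forall k, orthant (u k)) ->
  orthant x -> u @ \oo --> x -> (fun k => V (u k)) @ \oo --> V x.
Proof. by have [_ cV] := WV; exact: within_cvg_seq. Qed.

Lemma maxmin_push x : orthant x -> (fun k => V (push x k)) @ \oo --> V x.
Proof.
move=> x0; apply: maxmin_cvg => //; last exact: push_cvg.
by move=> k; apply/orthant_pos/push_pos.
Qed.

Lemma maxmin_ge0 x : orthant x -> 0 <= V x.
Proof.
move=> x0; apply: (ler_cvg_to (cvg_cst 0) (maxmin_push x0)).
by apply: nearW => k; apply/ltW/maxmin_pos_gt0/push_pos.
Qed.

Lemma maxmin_mono x y : orthant x -> orthant y -> vle x y -> V x <= V y.
Proof.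
move=> x0 y0 xy; apply: (ler_cvg_to (maxmin_push x0) (maxmin_push y0)).
apply: nearW => k; apply: maxmin_pos_mono; [exact: push_pos|exact: push_pos|].
by move=> i; rewrite !mxE lerD2r.
Qed.

Lemma maxmin_extend (f : 'rV[R]_n -> 'rV[R]_n) (phi : R -> R) x :
  continuous f -> continuous phi ->
  (forall y, orthant y -> orthant (f y)) ->
  (forall y, pos_orthant y -> V (f y) = phi (V y)) ->
  orthant x -> V (f x) = phi (V x).
Proof.
move=> cf cphi f0 fV x0.
have h1 : (fun k => phi (V (push x k))) @ \oo --> phi (V x).
  by apply: (@cvg_comp _ _ _ _ phi _ (nbhs (V x))); [exact: maxmin_push|exact: cphi].
have h2 : (fun k => V (f (push x k))) @ \oo --> V (f x).
  apply: maxmin_cvg; first by move=> k; apply/f0/orthant_pos/push_pos.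
    exact: f0.
  by apply: (@cvg_comp _ _ _ _ f _ (nbhs x)); [exact: push_cvg|exact: cf].
apply: cvg_unique h2 _; first exact: norm_hausdorff.
rewrite (_ : (fun k => _) = (fun k => phi (V (push x k)))) //.
by apply/funext => k; rewrite fV //; exact: push_pos.
Qed.

Lemma maxmin_perm x (p : 'S_n) : orthant x -> V (col_perm p x) = V x.
Proof.
apply: (@maxmin_extend (col_perm p) id).
- apply: rV_continuous => i.
  rewrite (_ : (fun x => _) = (fun x : 'rV[R]_n => x 0 (p i))).
    exact: coord_continuous.
  by apply/funext => y; rewrite mxE.
- by move=> t; exact: cvg_id.
- by move=> y; exact: orthant_perm.
- by move=> y; exact: maxmin_pos_perm.
Qed.

Lemma maxmin_scale l x : 0 < l -> orthant x ->
  V (vmul (const_mx l) x) = l * V x.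
Proof.
move=> l0; apply: (@maxmin_extend (vmul (const_mx l)) ( *%R l)).
- rewrite (_ : vmul _ = vmap (fun=> *%R l)); last first.
    by apply/funext => y; apply/rowP => i; rewrite !mxE.
  by apply: vmap_continuous => i; exact: mulrl_continuous.
- exact: mulrl_continuous.
- move=> y y0; apply: orthantP => i.
  by rewrite !mxE mulr_ge0 ?orthant_ge0 // ltW.
- by move=> y; exact: maxmin_pos_scale.
Qed.

Lemma maxmin_vpow m x : (0 < m)%N -> orthant x -> V (vpow m x) = V x ^+ m.
Proof.
move=> m0; apply: (@maxmin_extend (vpow m) (fun t => t ^+ m)).
- rewrite (_ : vpow m = vmap (fun i t => t ^+ m)); last first.
    by apply/funext => y; exact: vpowE.
  by apply: vmap_continuous => i; exact: exprn_continuous.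
- exact: exprn_continuous.
- by move=> y y0; apply: orthantP => i; rewrite !mxE exprn_ge0 ?orthant_ge0.
- by move=> y; exact: maxmin_pos_vpow.
Qed.

(** Some [m < 1] has [x] below the multiple [m] of [y]; monotonicity, homogeneity and [V y > 0] give
    the strict inequality. *)
Lemma maxmin_lt x y : orthant x -> vltall x y -> V x < V y.
Proof.
move=> x0 xy; have y0 i : 0 < y 0 i.
  exact: le_lt_trans (orthant_ge0 i x0) (xy i).
have yp : pos_orthant y by exact/pos_orthantP.
(* The start value [2^-1] keeps [m] positive even when [x] is zero. *)
pose m := \big[Num.max/2^-1]_i (x 0 i / y 0 i).
have m1 : m < 1.
  apply/bigmax_ltP; split=> [|i _]; first by lra.
  by rewrite ltr_pdivrMr ?mul1r.
have m0 : 0 < m by apply: lt_le_trans (bigmax_ge_id _ _ _ _); lra.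
apply: (@le_lt_trans _ _ (m * V y)).
  rewrite -maxmin_scale //; last exact: orthant_pos.
  apply: maxmin_mono => //; first exact/orthant_pos/vmul_const_pos.
  by move=> i; rewrite !mxE -ler_pdivrMr //; exact: le_bigmax.
by rewrite gtr_pMl // maxmin_pos_gt0.
Qed.

End MaxMin.

(** * Normalized problems and their Hausdorff limits *)

Section Normalization.
Variables (R : realType) (n : nat).
Implicit Types (a x y z : 'rV[R]_n) (S : set 'rV[R]_n) (i : 'I_n) (e : R).

Lemma problem_orthant S x : problem S -> S x -> orthant x.
Proof. by move=> [_ + _ _ _]; exact. Qed.

Lemma normalize_orthant S x : problem S -> orthant x -> orthant (normalize S x).
Proof.
move=> pS x0; apply: orthantP => i.
by rewrite mxE divr_ge0 ?orthant_ge0 // ltW // best_gt0.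
Qed.

Lemma normalize_vmul S a x : problem S -> vltall 0 a ->
  normalize (vmul a @` S) (vmul a x) = normalize S x.
Proof.
move=> pS a0; apply/rowP => i; rewrite !mxE best_vmul // -mulf_div divff ?mul1r //.
by have := a0 i; rewrite mxE => /lt0r_neq0.
Qed.

Lemma normalize_vpow S m x : problem S -> (0 < m)%N ->
  normalize (vpow m @` S) (vpow m x) = vpow m (normalize S x).
Proof.
by move=> pS m0; apply/rowP => i; rewrite !mxE best_vpow // expr_div_n.
Qed.

Lemma normalize_equal S i x : equal_problem S ->
  normalize S x = vmul (const_mx (best S i)^-1) x.
Proof.
by move=> [_ eS]; apply/rowP => j; rewrite !mxE mulrC (eS i j).
Qed.

Lemma normalize_perm S (p : 'S_n) x : equal_problem S ->
  normalize S (col_perm p x) = col_perm p (normalize S x).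
Proof. by move=> [_ eS]; apply/rowP => i; rewrite !mxE (eS i (p i)). Qed.

Lemma best_hausdorff S S' e i : problem S -> problem S' ->
  hausdorff_ball (S : hyperspace _) e S' -> `|best S i - best S' i| <= e.
Proof.
have le T T' : problem T -> problem T' ->
    hausdorff_ball (T : hyperspace _) e T' -> best T i <= best T' i + e.
  move=> pT pT' [TT' _]; have [x Tx <-] := best_attained i pT.
  have [y T'y /rV_ballP[_ /(_ i)]] := TT' x Tx; have := le_best i pT' T'y.
  by rewrite ltr_norml => ? /andP[_ ?]; lra.
move=> pS pS' SS'; have := le S S' pS pS' SS'.
have := le S' S pS' pS (hausdorff_ball_sym SS').
by rewrite ler_norml => ? ?; apply/andP; split; lra.
Qed.

Lemma cvg_best (Sk : nat -> hyperspace 'rV[R]_n) (S : hyperspace 'rV[R]_n) i :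
  (forall k, problem (Sk k)) -> problem S -> Sk @ \oo --> S ->
  (fun k => best (Sk k) i) @ \oo --> best S i.
Proof.
move=> pSk pS /cvg_ballP SkS; apply/cvgrPdist_le => e e0.
by apply: filterS (SkS e e0) => k; exact: best_hausdorff.
Qed.

Lemma cvg_normalize (Sk : nat -> hyperspace 'rV[R]_n) (S : hyperspace 'rV[R]_n)
    (xk : nat -> 'rV[R]_n) x :
  (forall k, problem (Sk k)) -> problem S -> Sk @ \oo --> S -> xk @ \oo --> x ->
  (fun k => normalize (Sk k) (xk k)) @ \oo --> normalize S x.
Proof.
move=> pSk pS SkS xkx; apply: cvg_rV => i; rewrite mxE.
rewrite (_ : (fun k => _) = (fun k => xk k 0 i / best (Sk k) i)); last first.
  by apply/funext => k; rewrite mxE.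
apply: cvgM; last first.
  by apply: cvgV; [rewrite gt_eqF // best_gt0|exact: cvg_best].
by apply: (@cvg_comp _ _ _ _ (fun z : 'rV[R]_n => z 0 i) _ (nbhs x)) => //;
  exact: coord_continuous.
Qed.

(* The nearest points of the approximating sets converge to [y]. *)
Lemma hausdorff_approx (Sk : nat -> hyperspace 'rV[R]_n)
    (S : hyperspace 'rV[R]_n) y :
  (forall k, problem (Sk k)) -> Sk @ \oo --> S -> S y ->
  exists2 yk : nat -> 'rV[R]_n, forall k, Sk k (yk k) & yk @ \oo --> y.
Proof.
move=> pSk SkS Sy.
(* A nearest point, which exists by compactness, serves every tolerance at once, so a single
   sequence can be chosen. *)
have near_pt k : exists z, Sk k z /\ forall t, Sk k t -> `|y - z| <= `|y - t|.
  have [Sk0 _ cSk _ _] := pSk k.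
  have cf : {within Sk k, continuous (fun z : 'rV[R]_n => `|y - z|)}.
    apply: continuous_subspaceT => z.
    apply: (@continuous_comp _ _ _ (fun z => y - z) Num.norm); last first.
      exact: norm_continuous.
    by apply: continuousB; [exact: cst_continuous|exact: cvg_id].
  have [z /set_mem Skz zmin] := compact_EVT_min Sk0 cSk cf.
  by exists z; split=> // t /mem_set; exact: zmin.
have [yk ykP] := choice near_pt; exists yk; first by move=> k; case: (ykP k).
apply/cvgrPdist_le => e e0; move/cvg_ballP: SkS => SkS.
apply: filterS (SkS e e0) => k [/(_ y Sy)[z Skz] + _]; rewrite -ball_normE /= => yz.
by have [_ /(_ z Skz)] := ykP k; move/le_trans; apply; exact: ltW.
Qed.

End Normalization.

(** * Max-min solutions satisfy the axioms *)

Section Sufficiency.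
Variables (R : realType) (n : nat) (i0 : 'I_n).
Variable F : set 'rV[R]_n -> set 'rV[R]_n.
Hypothesis F_sol : bargaining_solution F.
Variables (WW : set (hyperspace 'rV[R]_n)) (V : 'rV[R]_n -> R).
Hypothesis WW_sym : symmetric_collection WW.
Hypothesis WW_sub : forall W : set 'rV[R]_n, WW W ->
  [/\ W !=set0, closed W, convex_set W & W `<=` @weights R n].
Hypothesis WV : maxmin_geomean WW V.
Hypothesis FE : forall S : set 'rV[R]_n, problem S ->
  F S = argmax S (fun x => V (normalize S x)).
Implicit Types (x y z : 'rV[R]_n) (S : set 'rV[R]_n).

Lemma maxmin_pareto : intermediate_pareto F.
Proof.
move=> S pS; have S0 x := @problem_orthant _ _ S x pS; split=> [x|].
  rewrite FE // => -[Sx xmax] [y Sy xy]; have := xmax y Sy.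
  apply/negP; rewrite -ltNge; apply: (maxmin_lt WW_sub WV).
    exact/normalize_orthant/S0.
  by move=> i; rewrite !mxE ltr_pM2r // invr_gt0 best_gt0.
have [[x FSx] _] := F_sol pS; move: (FSx); rewrite FE // => -[Sx xmax].
(* A point of largest coordinate sum among those of [S] above the chosen [x] is still chosen, by
   monotonicity, and is undominated. *)
pose T := S `&` [set y | vle x y].
have [_ _ cS _ _] := pS.
have cT : compact T.
  apply: compact_closedI => //.
  rewrite (_ : [set y | _] =
    \bigcap_(i in setT) (fun y : 'rV[R]_n => y 0 i) @^-1` [set t | x 0 i <= t]).
    apply: closed_bigI => i _.
    apply: (iffLR (continuous_closedP _) (@coord_continuous R 1 n 0 i)).
    exact: closed_ge.
  by apply/seteqP; split=> y xy i => [_|]; exact: xy.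
have T0 : T !=set0 by exists x; split=> //; exact: vle_refl.
have [z /set_mem[Sz xz] zmax] := compact_EVT_max T0 cT
  (continuous_subspaceT (@dot_continuous R n (const_mx 1))).
have mono u v : S u -> S v -> vle u v -> V (normalize S u) <= V (normalize S v).
  move=> Su Sv uv; apply: (maxmin_mono WW_sub WV).
  - exact/normalize_orthant/S0.
  - exact/normalize_orthant/S0.
  - by move=> i; rewrite !mxE ler_pM2r // invr_gt0 best_gt0.
exists z; first by split=> // y Sy; apply: le_trans (mono _ _ Sx Sz xz); exact: xmax.
move=> [y Sy [zy]]; apply; apply: contrapT => zNy.
have yT : y \in T by apply/mem_set; split=> //; exact: vle_trans zy.
have := zmax y yT; rewrite !dot1; apply/negP; rewrite -ltNge.
have [i zi] : exists i, z 0 i < y 0 i.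
  apply: contra_notP zNy => h; apply: vle_anti => // i.
  by rewrite leNgt; apply/negP => ?; apply: h; exists i.
rewrite (bigD1 i) //= [ltRHS](bigD1 i) //= ltr_leD //.
by apply: ler_sum => j _; exact: zy.
Qed.

Lemma maxmin_scale_invariance : scale_invariance F.
Proof.
move=> S a pS a0; rewrite !FE //; last exact: problem_vmul.
apply/seteqP; split=> [_ [[x Sx <-] xmax]|_ [x [Sx xmax] <-]].
  exists x => //; split=> // y Sy.
  have := xmax (vmul a y) (ex_intro2 _ _ y Sy erefl).
  by rewrite !normalize_vmul.
split; first by exists x.
by move=> _ [y Sy <-]; rewrite !normalize_vmul //; exact: xmax.
Qed.

(** On a symmetric problem all maxima agree, so normalization commutes with permutations. *)
Lemma maxmin_anonymity : anonymity F.
Proof.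
move=> S pS sS x; have eS := symmetric_equal_problem pS sS.
rewrite FE // => -[Sx xmax] p; split; first by rewrite (sS p); exists x.
move=> y Sy; rewrite normalize_perm // (maxmin_perm WW_sym WW_sub WV).
  exact: xmax.
exact/normalize_orthant/(problem_orthant pS).
Qed.

(** A competitor [y] is approximated by points [yk] of the sets [Sk], where [xk] is at least as
    good; the inequality passes to the limit. *)
Lemma maxmin_continuity : continuity F.
Proof.
move=> S x pS Sx [Sk [xk [pSk Fxk SkS xkx]]]; rewrite FE //; split=> // y Sy.
have [yk Skyk yky] := hausdorff_approx pSk SkS Sy.
have Skxk k : Sk k (xk k) by have [_ sub] := F_sol (pSk k); exact: sub.
have lim (uk : nat -> 'rV[R]_n) u : (forall k, Sk k (uk k)) -> S u -> uk @ \oo --> u ->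
    (fun k => V (normalize (Sk k) (uk k))) @ \oo --> V (normalize S u).
  move=> Sku Su uku; apply: (maxmin_cvg WV).
  - by move=> k; apply/normalize_orthant/(problem_orthant (pSk k)).
  - exact/normalize_orthant/(problem_orthant pS).
  - exact: cvg_normalize.
apply: (ler_cvg_to (lim _ _ Skyk Sy yky) (lim _ _ Skxk Sx xkx)).
by apply: nearW => k; have := Fxk k; rewrite FE // => -[_]; exact.
Qed.

(** Normalization is here multiplication by one positive number, which homogeneity cancels. The
    objective no longer depends on the problem, whence weak IIA. *)
Lemma maxmin_argmax_equal S : equal_problem S -> F S = argmax S V.
Proof.
move=> eS; have [pS _] := eS; have b0 : 0 < (best S i0)^-1.
  by rewrite invr_gt0 best_gt0.
have h x y : S x -> S y ->
    (V (normalize S y) <= V (normalize S x)) = (V y <= V x).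
  move=> /(problem_orthant pS) x0 /(problem_orthant pS) y0.
  by rewrite !(normalize_equal i0) // !(maxmin_scale WW_sub WV) // ler_pM2l.
rewrite FE //; apply/seteqP; split=> x [Sx xmax]; split=> // y Sy.
  by rewrite -h //; exact: xmax.
by rewrite h //; exact: xmax.
Qed.

Lemma maxmin_weak_IIA : weak_IIA F.
Proof.
move=> S S' eS eS' sub [z [S'z]]; rewrite !maxmin_argmax_equal // => -[Sz zmax].
apply/seteqP; split=> [x [S'x xmax]|x [S'x [Sx xmax]]].
  by do 2!split=> //; [exact: sub|move=> y /zmax/le_trans; apply; exact: xmax].
by split=> // y /sub; exact: xmax.
Qed.

Lemma maxmin_timing : independence_of_timing F.
Proof.
move=> S x m pS Sx m0; rewrite !FE //; last exact: problem_vpow.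
have h y : S y ->
    (V (normalize (vpow m @` S) (vpow m y)) <=
     V (normalize (vpow m @` S) (vpow m x))) =
    (V (normalize S y) <= V (normalize S x)).
  have no z : S z -> orthant (normalize S z).
    by move=> ?; exact/normalize_orthant/(problem_orthant pS).
  move=> Sy; have [ny nx] := (no y Sy, no x Sx).
  rewrite !normalize_vpow // !(maxmin_vpow WW_sub WV) //.
  by rewrite ler_pXn2r // nnegrE (maxmin_ge0 WV).
split=> -[_ xmax].
  by split=> [|_ [y Sy <-]]; [exists x|rewrite h //; exact: xmax].
by split=> // y Sy; rewrite -h //; apply: xmax; exists y.
Qed.

End Sufficiency.

(** * Equivalence of the axioms with the max-min representation *)

Theorem proposition1 (R : realType) (n : nat) (hn : (2 <= n)%N)
    (F : set 'rV[R]_n -> set 'rV[R]_n) (hF : bargaining_solution F) :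
  [/\ intermediate_pareto F, scale_invariance F, anonymity F
    & [/\ continuity F, weak_IIA F & independence_of_timing F]]
  <->
  exists WW : set (hyperspace 'rV[R]_n),
    [/\ WW !=set0, symmetric_collection WW, compact WW,
        (forall W : set 'rV[R]_n, WW W ->
           [/\ W !=set0, closed W, convex_set W & W `<=` @weights R n])
      & exists2 V : 'rV[R]_n -> R, maxmin_geomean WW V &
          forall S : set 'rV[R]_n, problem S ->
            F S = argmax S (fun x => V (normalize S x))].
Proof.
have i0 : 'I_n by apply: (Ordinal (n := n) (m := 0)); exact: leq_trans hn.
split=> [[Fpar Fscale Fanon [Fcont FIIA Ftime]]|]; last first.
  move=> [WW [WW0 WW_sym _ WW_sub [V WV FE]]]; split.
  - exact: maxmin_pareto WW_sub WV FE.
  - exact: maxmin_scale_invariance FE.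
  - exact: maxmin_anonymity WW_sub WV FE.
  split.
  - exact: maxmin_continuity WV FE.
  - exact: (maxmin_weak_IIA i0) WW_sub WV FE.
  - exact: maxmin_timing WW_sub WV FE.
pose V := value F.
have V_mono : forall x y, orthant x -> orthant y -> vle x y -> V x <= V y.
  exact: value_mono.
have V_scale : forall (l : R) x, 0 < l -> orthant x ->
  V (vmul (const_mx l) x) = l * V x by exact: value_scale.
have V_vpow : forall m x, (0 < m)%N -> orthant x -> V (vpow m x) = V x ^+ m.
  exact: value_vpow.
have V_const : forall t : R, 0 <= t -> V (const_mx t) = t by exact: value_const.
have V_perm : forall x (p : 'S_n), orthant x -> V (col_perm p x) = V x.
  exact: value_perm.
pose g := log_value V.
have g_mono : forall u v, vle u v -> g u <= g v by exact: log_value_mono.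
have g_shift : forall u c, g (u + const_mx c) = g u + c by exact: log_value_shift.
(* Independence of timing gives homogeneity for positive integers; monotonicity and translation
   equivariance extend it to nonnegative reals. *)
have g_scale : forall l u, 0 <= l -> g (l *: u) = l * g u.
  by apply: (@homogeneous_of_natmul R n g) => //; exact: log_value_natmul.
have g_perm : forall u (p : 'S_n), g (col_perm p u) = g u by exact: log_value_perm.
exists (collection g); split.
- exact: collection_neq0.
- exact: symmetric_collection_hulls.
- exact: compact_collection.
- exact: collection_convex.
exists V; last by move=> S; exact: F_argmax.
split; last exact: value_continuous.
by move=> y y0; rewrite -(exp_log_value V_mono V_const) //; exact: maxmin_collection.
Qed.
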